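(* For every finite set $F\subset\mathbb{F}_q[U][X]$, the algorithm $\mathsf{ParaRadical}$ (described in the context) applied to $F$ terminates after finitely many steps, and its output $\mathcal{R}=\{(E_1,N_1,G_1),\dots,(E_r,N_r,G_r)\}$ is a parametric radical system of $\langle F\rangle$ on $\mathbb{F}_q^m$. That is: the sets $\mathbf{V}(E_i)\setminus\mathbf{V}(N_i)$, $i=1,\dots,r$, form an algebraic partition of $\mathbb{F}_q^m$, and for every $i$ and every $a\in\mathbf{V}(E_i)\setminus\mathbf{V}(N_i)$ the set $\pi_a(G_i)$ generates the radical $\sqrt{\langle\pi_a(F)\rangle}$ in $\mathbb{F}_q[X]$.
   Context: **Notation.** $q$ is a power of a prime $p$, $\mathbb{F}_q$ is the field with $q$ elements. $U=\{u_1,\dots,u_m\}$ (parameters) and $X=\{x_1,\dots,x_n\}$ are disjoint sets of variables, and $\mathbb{F}_q[U][X]$ is the polynomial ring in $X$ over $\mathbb{F}_q[U]$. Fix a term order $\prec$ on the set $\mathrm{Term}(X)$ of power products of $X$. For nonzero $f\in\mathbb{F}_q[U][X]$, $\mathrm{lpp}(f)\in\mathrm{Term}(X)$ and $\mathrm{lc}(f)\in\mathbb{F}_q[U]$ are the leading power product and leading coefficient of $f$, viewed as a polynomial in $X$ with coefficients in $\mathbb{F}_q[U]$. For $a\in\mathbb{F}_q^m$, $\pi_a$ is the specialization map substituting $a$ for $U$ (applied elementwise to sets). For $E\subset\mathbb{F}_q[U]$, $\mathbf{V}(E)=\{a\in\mathbb{F}_q^m: g(a)=0\ \forall g\in E\}$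 (so $\mathbf V(\emptyset)=\mathbb F_q^m$). For finite $C_1,C_2\subset\mathbb{F}_q[U]$, $C_1\cdot C_2=\{fg: f\in C_1,g\in C_2\}$. **Algebraic partition.** Non-empty sets $S_1,\dots,S_r\subset\mathbb{F}_q^m$ form an algebraic partition of $S\subset\mathbb{F}_q^m$ if each $S_i=\mathbf{V}(E_i)\setminus\mathbf{V}(N_i)$ for some finite $E_i,N_i\subset\mathbb{F}_q[U]$, the $S_i$ are pairwise disjoint, and $S=\bigcup_i S_i$. **CGS.** Let $F\subset\mathbb{F}_q[U][X]$ and $E,N\subset\mathbb{F}_q[U]$ be finite. A finite set of triples (''segments'') $\{(E_i,N_i,G_i)\}_{i=1}^r$, with $E_i,N_i\subset\mathbb{F}_q[U]$ and $G_i\subset\mathbb{F}_q[U][X]$ finite, is a comprehensive Gröbner system (CGS) of $\langle F\rangle$ on $\mathbf{V}(E)\setminus\mathbf{V}(N)$ with respect to $\prec$ if (i) the sets $\mathbf{V}(E_i)\setminus\mathbf{V}(N_i)$ form an algebraic partition of $\mathbf{V}(E)\setminus\mathbf{V}(N)$; (ii) for each $i$, either for all $a\in\mathbf{V}(E_i)\setminus\mathbf{V}(N_i)$ one has $\pi_a(\mathrm{lc}(g))\ne0$ for all $g\in G_i$ and $\pi_a(G_i)$ is a minimal (not necessarily monic) Gröbner basis of the nonzero ideal $\langle\pi_a(F)\rangle\subset\mathbb{F}_q[X]$ with respect to $\prec$, or $G_i=\{0\}$ and $\langle\pi_a(F)\rangle=0$ for all such $a$. The same definition is used with other sets of variables in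 place of $X$. Wherever an algorithm below asks for ''a CGS'', any CGS obtained by a terminating subroutine may be used. **$\mathsf{ParaInverseFrobeniusMap}(E,N,F)$.** Introduce new variables $Y=\{y_1,\dots,y_n\}$ and let $B=F\cup\{y_1-x_1^q,\dots,y_n-x_n^q\}\subset\mathbb{F}_q[U][X,Y]$. Compute a CGS $\{(E_i,N_i,G_i)\}_i$ of $\langle B\rangle$ on $\mathbf{V}(E)\setminus\mathbf{V}(N)$ with respect to a block order with $X\gg Y$ on power products in $X\cup Y$, whose restriction to power products in $Y$ corresponds to $\prec$ under $y_j\mapsto x_j$. Return $\{(E_i,N_i,H_i)\}_i$, where $H_i$ is obtained from $G_i\cap\mathbb{F}_q[U][Y]$ by replacing each $y_j$ with $x_j$. **Parametric remainder.** Let $(E,N,G)$ be a segment of a CGS with $G\neq\{0\}$. For $f\in\mathbb{F}_q[U][X]$ let $\rho_G(f)\in\mathbb{F}_q(U)[X]$ be the remainder of dividing $f$ by $G$ (with the usual division algorithm in $\mathbb{F}_q(U)[X]$ with respect to $\prec$). Choose $c_f\in\mathbb{F}_q[U]\setminus\{0\}$ with $c_f\rho_G(f)\in\mathbb{F}_q[U][X]$ and $\pi_a(c_f)\ne0$ for all $a\in\mathbf{V}(E)\setminus\mathbf{V}(N)$ (e.g. a suitable product of powers of the leading coefficients of the elements of $G$), and put $\mathrm{prem}_G(f)=c_f\rho_G(f)$. **$\mathsf{ParaIdealEqualityLCS}((E,N,G),(\tilde E,\tilde N,\tilde G))$.** Let $H\subset\mathbb{F}_q[U]$ be the set of all coefficients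 (as polynomials in $X$) of all $\mathrm{prem}_G(g)$, $g\in\tilde G$. Return the two triples $(E_{\mathcal E},N_{\mathcal E},G_{\mathcal E})=(\tilde E\cup H,\tilde N,G)$ and $(E_{\mathcal N},N_{\mathcal N},G_{\mathcal N})=(\tilde E,\tilde N\cdot H,\tilde G)$. **$\mathsf{IsEmptyLCS}(E,N)$.** Decides whether $\mathbf{V}(E)\setminus\mathbf{V}(N)=\emptyset$, by testing whether every element of $N$ lies in the ideal $\langle E\cup\{u_1^q-u_1,\dots,u_m^q-u_m\}\rangle$ of $\mathbb{F}_q[U]$ (returning TRUE if $N=\emptyset$). **$\mathsf{ParaRadicalMain}(E,N,G)$.** Set $\mathcal{R}=\emptyset$ and $\mathcal{H}=\mathsf{ParaInverseFrobeniusMap}(E,N,G)$. For each $(E_i,N_i,G_i)\in\mathcal{H}$: compute $(E_{\mathcal E},N_{\mathcal E},G_{\mathcal E}),(E_{\mathcal N},N_{\mathcal N},G_{\mathcal N})$ by $\mathsf{ParaIdealEqualityLCS}((E,N,G),(E_i,N_i,G_i))$; if $\mathbf{V}(E_{\mathcal E})\setminus\mathbf{V}(N_{\mathcal E})\neq\emptyset$ (tested by $\mathsf{IsEmptyLCS}$), add $(E_{\mathcal E},N_{\mathcal E},G_{\mathcal E})$ to $\mathcal{R}$; if $\mathbf{V}(E_{\mathcal N})\setminus\mathbf{V}(N_{\mathcal N})\ne\emptyset$ (tested by $\mathsf{IsEmptyLCS}$), add all elements of $\mathsf{ParaRadicalMain}(E_{\mathcal N},N_{\mathcal N},G_{\mathcal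 N})$ to $\mathcal{R}$. Return $\mathcal{R}$. **$\mathsf{ParaRadical}(F)$.** Set $\mathcal{R}=\emptyset$ and compute a CGS $\mathcal{G}$ of $\langle F\rangle$ on $\mathbb{F}_q^m$ with respect to $\prec$. For each $(E_i,N_i,G_i)\in\mathcal{G}$: if $G_i=\{0\}$ or $G_i=\{1\}$, add $(E_i,N_i,G_i)$ to $\mathcal{R}$; otherwise add all elements of $\mathsf{ParaRadicalMain}(E_i,N_i,G_i)$ to $\mathcal{R}$. Return $\mathcal{R}$. *)

(* Defs.v *)
From HB Require Import structures.
From mathcomp Require Import all_boot all_order all_algebra.
From mathcomp Require Import finmap mpoly fraction.

Set Implicit Arguments.
Unset Strict Implicit.
Unset Printing Implicit Defensive.

Import GRing.Theory.

Local Open Scope ring_scope.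
Local Open Scope fset_scope.

(* The field F_q is an arbitrary [K : finFieldType], so that q = #|K|.
   F_q[U][X] is [{mpoly {mpoly K[m]}[n]}]. Power products of X are the monomials
   'X_{1..n}; (m1 <= m2)%MM is divisibility and m1 + m2, m1 - m2 are
   multiplication and division of power products. *)

Definition term_order n (le : rel 'X_{1..n}) : Prop :=
  [/\ total le, antisymmetric le, transitive le,
      forall t, le 0%MM t
    & forall s t u, le s t -> le (s + u)%MM (t + u)%MM].

Section LeadingTerms.
Variables (n : nat) (le : rel 'X_{1..n}) (R : nzRingType).

(* The maximum of the support for [le]; the starting value 0 is the least
   element of a term order. Equals 0 at the zero polynomial. *)
Definition lpp (f : {mpoly R[n]}) : 'X_{1..n} :=
  \big[(fun s t => if le s t then t else s)/0%MM]_(t <- msupp f) t.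

Definition lc (f : {mpoly R[n]}) : R := f@_(lpp f).

Definition lterm (f : {mpoly R[n]}) : {mpoly R[n]} := lc f *: 'X_[lpp f].

End LeadingTerms.

Section Ideals.
Variable R : comNzRingType.

Definition ideal_gen (S : {fset R}) (f : R) : Prop :=
  exists c : R -> R, f = \sum_(g <- S) c g * g.

Definition radical (I : R -> Prop) (f : R) : Prop :=
  exists2 k : nat, (0 < k)%N & I (f ^+ k).

End Ideals.

Section MinimalGroebnerBasis.
Variables (n : nat) (le : rel 'X_{1..n}) (k : fieldType).

Definition groebner_basis (I : {mpoly k[n]} -> Prop) (G : {fset {mpoly k[n]}})
  : Prop :=
  [/\ forall g, g \in G -> g != 0,
      forall g, g \in G -> I g
    & forall f, I f -> f != 0 ->
        exists2 g, g \in G & (lpp le g <= lpp le f)%MM].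

Definition minimal_groebner_basis (I : {mpoly k[n]} -> Prop)
    (G : {fset {mpoly k[n]}}) : Prop :=
  groebner_basis I G /\
  forall g h, g \in G -> h \in G -> g != h -> ~~ (lpp le g <= lpp le h)%MM.

End MinimalGroebnerBasis.

Notation point K m := {ffun 'I_m -> K}.

Notation segment K m n :=
  ({fset {mpoly K[m]}} * {fset {mpoly K[m]}}
     * {fset {mpoly {mpoly K[m]}[n]}})%type.

Definition zeros (K : finFieldType) m (E : {fset {mpoly K[m]}})
  : {set point K m} :=
  [set a : point K m | all (fun g : {mpoly K[m]} => g.@[a] == 0) E].

Section Segments.
Variables (K : finFieldType) (m n : nat).

Definition seg_E (s : segment K m n) : {fset {mpoly K[m]}} := s.1.1.
Definition seg_N (s : segment K m n) : {fset {mpoly K[m]}} := s.1.2.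
Definition seg_G (s : segment K m n) : {fset {mpoly {mpoly K[m]}[n]}} := s.2.

Definition seg_locus (s : segment K m n) : {set point K m} :=
  zeros (seg_E s) :\: zeros (seg_N s).

Definition algebraic_partition (S : {set point K m})
    (C : {fset segment K m n}) : Prop :=
  [/\ forall s, s \in C -> seg_locus s != finset.set0,
      forall s t, s \in C -> t \in C -> s != t ->
        [disjoint seg_locus s & seg_locus t]%bool
    & forall a, a \in S <-> exists2 s, s \in C & a \in seg_locus s].

Definition specialize (a : point K m) (f : {mpoly {mpoly K[m]}[n]})
  : {mpoly K[n]} := map_mpoly (meval a) f.

Definition specialize_set (a : point K m) (F : {fset {mpoly {mpoly K[m]}[n]}})
  : {fset {mpoly K[n]}} := [fset specialize a f | f in F].

Definition special_ideal (a : point K m) (F : {fset {mpoly {mpoly K[m]}[n]}})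
  : {mpoly K[n]} -> Prop := ideal_gen (specialize_set a F).

Definition is_CGS (le : rel 'X_{1..n}) (F : {fset {mpoly {mpoly K[m]}[n]}})
    (S : {set point K m}) (C : {fset segment K m n}) : Prop :=
  algebraic_partition S C /\
  forall s, s \in C ->
    (forall a, a \in seg_locus s ->
       [/\ forall g, g \in seg_G s -> (lc le g).@[a] != 0,
           exists2 f, special_ideal a F f & f != 0
         & minimal_groebner_basis le (special_ideal a F)
             (specialize_set a (seg_G s))])
    \/
    (seg_G s = [fset 0] /\
     forall a, a \in seg_locus s -> forall f, special_ideal a F f -> f = 0).

Definition parametric_radical_system (F : {fset {mpoly {mpoly K[m]}[n]}})
    (S : {set point K m}) (C : {fset segment K m n}) : Prop :=
  algebraic_partition S C /\
  forall s a, s \in C -> a \in seg_locus s ->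
    forall f, special_ideal a (seg_G s) f <-> radical (special_ideal a F) f.

End Segments.

(* The variables of X u Y are indexed by 'I_(n + n): x_i is [lshift n i] and
   y_i is [rshift n i]. *)
Section ElimVariables.
Variable n : nat.

Definition x_part (t : 'X_{1..n + n}) : 'X_{1..n} :=
  [multinom t (lshift n i) | i < n].

Definition y_part (t : 'X_{1..n + n}) : 'X_{1..n} :=
  [multinom t (rshift n i) | i < n].

Definition block_order (leX leY : rel 'X_{1..n}) : rel 'X_{1..n + n} :=
  fun s t => if x_part s == x_part t then leY (y_part s) (y_part t)
             else leX (x_part s) (x_part t).

Variable R : comNzRingType.

Definition embed_X (f : {mpoly R[n]}) : {mpoly R[n + n]} :=
  f \mPo [tuple 'X_(lshift n i) | i < n].

Definition only_Y (f : {mpoly R[n + n]}) : bool :=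
  all (fun t => x_part t == 0%MM) (msupp f).

(* Replaces y_j by x_j. Only applied to polynomials satisfying [only_Y], so
   that the value given to the variables x_i is irrelevant. *)
Definition rename_Y (f : {mpoly R[n + n]}) : {mpoly R[n]} :=
  f \mPo [tuple match split i with inl _ => 0 | inr j => 'X_j end
         | i < n + n].

End ElimVariables.

Section Algorithms.
Variables (K : finFieldType) (m n : nat) (le : rel 'X_{1..n}).

Local Notation coef := {mpoly K[m]}.
Local Notation pol := {mpoly {mpoly K[m]}[n]}.
Local Notation fpol := {mpoly {fraction {mpoly K[m]}}[n]}.
Local Notation seg := (segment K m n).

(* The algorithms make choices (of a CGS, of the first component of the block
   order, of the divisor used in a division step, of c_f). Each is a relation
   between its input and all its possible outputs. *)

Definition frobenius_graph (F : {fset pol}) : {fset {mpoly coef[n + n]}} :=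
  [fset embed_X f | f in F] `|`
  [fset 'X_(rshift n i) - 'X_(lshift n i) ^+ #|K| | i in 'I_n].

Definition ParaInverseFrobeniusMap (s : seg) (out : {fset seg}) : Prop :=
  exists (leX : rel 'X_{1..n}) (C : {fset segment K m (n + n)}),
    [/\ term_order leX,
        is_CGS (block_order leX le) (frobenius_graph (seg_G s)) (seg_locus s) C
      & out = [fset (seg_E t, seg_N t,
                     [fset rename_Y g | g in seg_G t & only_Y g]) | t in C]].

Definition to_fpol (f : pol) : fpol := map_mpoly (@tofrac _) f.

(* [division G p r]: the division algorithm by G in F_q(U)[X], run with current
   dividend p, yields the remainder r. *)
Inductive division (G : {fset pol}) : fpol -> fpol -> Prop :=
| division_stop : division G 0 0
| division_reduce (p r : fpol) (g : pol) :
    p != 0 -> g \in G -> g != 0 -> (lpp le (to_fpol g) <= lpp le p)%MM ->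
    division G
      (p - (lc le p / lc le (to_fpol g))
             *: ('X_[(lpp le p - lpp le (to_fpol g))%MM] * to_fpol g)) r ->
    division G p r
| division_shift (p r : fpol) :
    p != 0 ->
    (forall g, g \in G -> g != 0 ->
       ~~ (lpp le (to_fpol g) <= lpp le p)%MM) ->
    division G (p - lterm le p) r ->
    division G p (lterm le p + r).

Definition is_prem (s : seg) (f h : pol) : Prop :=
  exists (r : fpol) (c : coef),
    [/\ division (seg_G s) (to_fpol f) r, c != 0,
        forall a, a \in seg_locus s -> c.@[a] != 0
      & to_fpol h = tofrac c *: r].

Definition coefficients (f : pol) : {fset coef} :=
  [fset f@_t | t in msupp f].

Definition ParaIdealEqualityLCS (s t : seg) (out : seg * seg) : Prop :=
  exists prem : pol -> pol,
    (forall g, g \in seg_G t -> is_prem s g (prem g)) /\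
    let H := \bigcup_(g <- seg_G t) coefficients (prem g) in
    out = ((seg_E t `|` H, seg_N t, seg_G s),
           (seg_E t, [fset f * h | f in seg_N t, h in H], seg_G t)).

Definition IsEmptyLCS (E N : {fset coef}) : Prop :=
  forall g, g \in N ->
    ideal_gen (E `|` [fset 'X_i ^+ #|K| - 'X_i | i in 'I_m]) g.

Definition nonempty_test (s : seg) : Prop := ~ IsEmptyLCS (seg_E s) (seg_N s).

Inductive ParaRadicalMain : seg -> {fset seg} -> Prop :=
| ParaRadicalMain_return (s : seg) (H : {fset seg})
    (eqn : seg -> seg * seg) (rec : seg -> {fset seg}) (out : {fset seg}) :
    ParaInverseFrobeniusMap s H ->
    (forall t, t \in H -> ParaIdealEqualityLCS s t (eqn t)) ->
    (forall t, t \in H -> nonempty_test (eqn t).2 ->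
       ParaRadicalMain (eqn t).2 (rec t)) ->
    (forall u, u \in out <->
       exists2 t, t \in H &
         (nonempty_test (eqn t).1 /\ u = (eqn t).1) \/
         (nonempty_test (eqn t).2 /\ u \in rec t)) ->
    ParaRadicalMain s out.

(* No execution on s gets stuck (every subroutine called has some possible
   output) and every execution is finite (by being an inductive predicate). *)
Inductive ParaRadicalMain_terminates : seg -> Prop :=
| ParaRadicalMain_step (s : seg) :
    (exists H, ParaInverseFrobeniusMap s H) ->
    (forall H t, ParaInverseFrobeniusMap s H -> t \in H ->
       exists eqn, ParaIdealEqualityLCS s t eqn) ->
    (forall H t eqn, ParaInverseFrobeniusMap s H -> t \in H ->
       ParaIdealEqualityLCS s t eqn -> nonempty_test eqn.2 ->
       ParaRadicalMain_terminates eqn.2) ->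
    ParaRadicalMain_terminates s.

Definition trivial_basis (s : seg) : bool :=
  (seg_G s == [fset 0]) || (seg_G s == [fset 1]).

Definition ParaRadical (F : {fset pol}) (out : {fset seg}) : Prop :=
  exists (C : {fset seg}) (main : seg -> {fset seg}),
    [/\ is_CGS le F finset.setT C,
        forall s, s \in C -> ~~ trivial_basis s -> ParaRadicalMain s (main s)
      & forall u, u \in out <->
          exists2 s, s \in C & if trivial_basis s then u = s else u \in main s].

Definition ParaRadical_terminates (F : {fset pol}) : Prop :=
  (exists C, is_CGS le F finset.setT C) /\
  (forall C s, is_CGS le F finset.setT C -> s \in C -> ~~ trivial_basis s ->
     ParaRadicalMain_terminates s).

End Algorithms.

(* Main.v *)
(** Everything is checked pointwise: fix a point [a] and write I for the ideal
    generated by the specialized input. Modulo y_i - x_i^q a polynomial f(y) is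
    f(x^q) = f(x)^q, so eliminating X turns I into I' = {f | f^q \in I}, and
    I <= I' <= sqrt I. The two segments returned by the equality test separate
    the points where I' = I, so that I is already radical, from those where
    I' is larger and has the same radical. Since sqrt I is finitely generated,
    there is N with f^(q^N) \in I for all f \in sqrt I, and N drops by one in
    each recursive call; N can be chosen uniformly because F_q^m is finite.
    That finiteness also yields comprehensive Groebner systems at once, with
    one segment per point. *)

From HB Require Import structures.
Require Import Defs.
From mathcomp Require Import all_boot all_order all_algebra all_field.
From mathcomp Require Import finmap mpoly fraction.
From Stdlib Require Import ClassicalEpsilon.

Set Implicit Arguments.
Unset Strict Implicit.
Unset Printing Implicit Defensive.

Import GRing.Theory.

Local Open Scope fset_scope.
Local Open Scope ring_scope.

(** The exponent is q rather than p because the q-th power also fixes the coefficients: f(x)^q =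
    f(x^q) then holds without twisting the coefficients by a Frobenius. The obstacle is the passage
    from F_q(U) to a point: remainders carry denominators there, and leading monomials may drop.
    Both are controlled by one condition, that the leading coefficients of a basis do not vanish at
    the points of its locus: division inverts only these coefficients, and leading monomials then
    survive specialization. The equality test checks the single inclusion of I' in I, the other one
    being automatic. Since only F_q-points count, emptiness of a locus is decided after adding the
    equations u^q = u, for which Lagrange interpolation supplies explicit certificates. *)

Lemma finite_choice (T : eqType) (U : Type) (u0 : U) (D : pred T)
    (P : T -> U -> Prop) :
  (forall t, D t -> exists u, P t u) ->
  exists f : T -> U, forall t, D t -> P t (f t).
Proof.
(* [u0] makes the relation total, so that description also applies outside [D]. *)
move=> exP; have exQ t : exists u, D t -> P t u.
  by case: (boolP (D t)) => [/exP[u Pu]|_]; [exists u | exists u0].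
exists (fun t => proj1_sig (constructive_indefinite_description _ (exQ t))).
by move=> t; apply: (proj2_sig (constructive_indefinite_description _ (exQ t))).
Qed.

(** * Ideals *)

Record is_ideal (R : comNzRingType) (I : R -> Prop) : Prop := IsIdeal {
  ideal0 : I 0;
  idealD : forall f g, I f -> I g -> I (f + g);
  idealM : forall c f, I f -> I (c * f) }.

Section IdealTheory.
Variable R : comNzRingType.
Implicit Types (I : R -> Prop) (S : {fset R}).

Lemma idealN I f : is_ideal I -> I f -> I (- f).
Proof. by move=> idI If; rewrite -mulN1r; apply: idealM. Qed.

Lemma idealB I f g : is_ideal I -> I f -> I g -> I (f - g).
Proof. by move=> idI If Ig; apply: idealD => //; apply: idealN. Qed.

Lemma ideal_sum I (T : eqType) (r : seq T) (F : T -> R) :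
  is_ideal I -> (forall t, t \in r -> I (F t)) -> I (\sum_(t <- r) F t).
Proof.
move=> idI IF; rewrite big_seq; elim/big_rec: _ => [|t f rt If].
  exact: ideal0.
by apply: idealD => //; apply: IF.
Qed.

Lemma ideal_gen_is_ideal S : is_ideal (ideal_gen S).
Proof.
split=> [|f g [c ->] [d ->]|a f [c ->]].
- by exists (fun=> 0); rewrite big1 // => g _; rewrite mul0r.
- exists (fun h => c h + d h); rewrite -big_split /=.
  by apply: eq_bigr => h _; rewrite mulrDl.
- exists (fun h => a * c h); rewrite big_distrr /=.
  by apply: eq_bigr => h _; rewrite mulrA.
Qed.

Lemma mem_ideal_gen S g : g \in S -> ideal_gen S g.
Proof.
move=> Sg; exists (fun h => (h == g)%:R).
rewrite (bigD1_seq g) ?fset_uniq //= eqxx mul1r big1 ?addr0 //.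
by move=> h /negPf ->; rewrite mul0r.
Qed.

Lemma ideal_gen_least S I f :
  is_ideal I -> (forall g, g \in S -> I g) -> ideal_gen S f -> I f.
Proof.
move=> idI SI [c ->]; apply: ideal_sum => // g Sg.
by apply: idealM => //; apply: SI.
Qed.

End IdealTheory.

Lemma ideal_preim (R R' : comNzRingType) (phi : {rmorphism R -> R'})
    (I : R' -> Prop) : is_ideal I -> is_ideal (fun f => I (phi f)).
Proof.
move=> idI; split=> [|f g|c f]; rewrite ?rmorph0 ?rmorphD ?rmorphM.
- exact: ideal0.
- exact: idealD.
- exact: idealM.
Qed.

Lemma ideal_gen_rmorph (R R' : comNzRingType) (phi : {rmorphism R -> R'})
    (S : {fset R}) (I : R' -> Prop) f :
  is_ideal I -> (forall g, g \in S -> I (phi g)) -> ideal_gen S f -> I (phi f).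
Proof. by move=> /(ideal_preim phi); apply: ideal_gen_least. Qed.

(** * Dickson's lemma and term orders *)

(** Induction on the number of coordinates. Arbitrary coordinate functions and an arbitrary [P] let
    the slices with a prescribed last coordinate be instances of the same statement. *)
Lemma dickson_coords (T : eqType) (n : nat) (c : nat -> T -> nat)
    (P : T -> Prop) :
  exists L : seq T, (forall t, t \in L -> P t) /\
    forall t, P t -> exists2 s, s \in L &
      forall i, (i < n)%N -> (c i s <= c i t)%N.
Proof.
elim: n P => [|n IHn] P.
  case: (classic (exists t, P t)) => [[t Pt]|noP]; last first.
    by exists [::]; split=> // t Pt; case: noP; exists t.
  exists [:: t]; split=> [u|u _]; first by rewrite inE => /eqP ->.
  by exists t; rewrite ?inE.
have [L [LP Lb]] := IHn P.
(* Elements with last coordinate below [N] lie in finitely many slices, each handled by [IHn]. *)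
have bounded N : exists L' : seq T, (forall t, t \in L' -> P t) /\
    forall t, P t -> (c n t < N)%N -> exists2 s, s \in L' &
      forall i, (i < n.+1)%N -> (c i s <= c i t)%N.
  elim: N => [|N [L1 [L1P L1b]]]; first by exists [::].
  have [L2 [L2P L2b]] := IHn (fun t => P t /\ c n t = N).
  exists (L1 ++ L2); split=> [t|t Pt].
    by rewrite mem_cat => /orP[/L1P|/L2P[]].
  rewrite ltnS leq_eqVlt => /orP[/eqP ctN|ltN].
    have [s L2s le_s] := L2b t (conj Pt ctN).
    exists s => [|i]; first by rewrite mem_cat L2s orbT.
    rewrite ltnS leq_eqVlt => /orP[/eqP->|/le_s //].
    by rewrite ctN; case: (L2P _ L2s) => _ ->.
  have [s L1s le_s] := L1b t Pt ltN.
  by exists s => //; rewrite mem_cat L1s.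
(* From this bound on, the last coordinate of any element of [L] is dominated automatically. *)
pose N := (\max_(s <- L) c n s)%N.
have [L' [L'P L'b]] := bounded N.
exists (L ++ L'); split=> [t|t Pt].
  by rewrite mem_cat => /orP[/LP|/L'P].
have [ltN|leN] := ltnP (c n t) N.
  have [s L's le_s] := L'b t Pt ltN.
  by exists s => //; rewrite mem_cat L's orbT.
have [s Ls le_s] := Lb t Pt.
exists s => [|i]; first by rewrite mem_cat Ls.
rewrite ltnS leq_eqVlt => /orP[/eqP->|/le_s //].
by apply: leq_trans leN; apply: leq_bigmax_seq.
Qed.

(** The antichain clause is what later makes a Groebner basis minimal. *)
Lemma dickson n (P : 'X_{1..n} -> Prop) :
  exists L : seq 'X_{1..n},
    [/\ forall t, t \in L -> P t,
        forall t, P t -> exists2 s, s \in L & (s <= t)%MM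
      & forall s t, s \in L -> t \in L -> (s <= t)%MM -> s = t].
Proof.
have [L [LP Lb]] := dickson_coords n (fun i (t : 'X_{1..n}) => nth 0%N t i) P.
pose minL t := all (fun s => (s <= t)%MM ==> (s == t)) L.
exists [seq t <- L | minL t]; split.
- by move=> t; rewrite mem_filter => /andP[_ /LP].
- move=> t /Lb[s Ls les].
  have {les} : (s <= t)%MM.
    by apply/mnm_lepP => i; rewrite !(mnm_nth 0%N); apply: les.
  (* Passing to a proper divisor inside [L] lowers the degree, so the descent reaches a minimal
     element. *)
  have [d] := ubnP (mdeg s); elim: d s Ls => // d IHd s Ls.
  rewrite ltnS => degs st; have [mins|/allPn[u Lu]] := boolP (minL s).
    by exists s; rewrite // mem_filter mins.
  rewrite negb_imply => /andP[us neus].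
  apply: (IHd u) => //; last exact: lepm_trans us st.
  apply: leq_trans degs; rewrite -(submK us) mdegD.
  rewrite -[X in (X < _)%N]add0n ltn_add2r lt0n mdeg_eq0.
  by apply: contraNneq neus => su0; rewrite -(submK us) su0 add0m.
- move=> s t; rewrite !mem_filter => /andP[_ Ls] /andP[/allP mint Lt] st.
  by apply/eqP; have /implyP := mint s Ls; apply.
Qed.

Section TermOrder.
Variables (n : nat) (le : rel 'X_{1..n}).
Hypothesis hle : term_order le.
Implicit Types (s t u : 'X_{1..n}).

Lemma to_refl s : le s s.
Proof. by case: hle => /(_ s s); rewrite orbb. Qed.

Lemma to_total s t : le s t || le t s.
Proof. by case: hle. Qed.

Lemma to_anti s t : le s t -> le t s -> s = t.
Proof. by case: hle => _ anti _ _ _ st ts; apply: anti; rewrite st. Qed.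

Lemma to_trans t s u : le s t -> le t u -> le s u.
Proof. by case: hle => _ _ trans _ _; apply: trans. Qed.

Lemma to_add s t u : le s t -> le (s + u)%MM (t + u)%MM.
Proof. by case: hle => _ _ _ _; apply. Qed.

Lemma to_ge0 t : le 0%MM t.
Proof. by case: hle. Qed.

Lemma lepm_to s t : (s <= t)%MM -> le s t.
Proof.
by move=> /submK <-; rewrite -{1}[s]add0m; apply/to_add/to_ge0.
Qed.

(** Well-foundedness from Dickson: the counterexamples have a finite basis for divisibility, and
    since divisibility implies [le], the [le]-least element of that basis is a least
    counterexample. *)
Lemma to_ind (P : 'X_{1..n} -> Prop) :
  (forall t, (forall s, le s t -> s != t -> P s) -> P t) -> forall t, P t.
Proof.
move=> IH t; apply: NNPP => nPt.
have [L [LP Lb _]] := dickson (fun s => ~ P s).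
have minL (L' : seq 'X_{1..n}) s : s \in L' ->
    exists2 u, u \in L' & forall v, v \in L' -> le u v.
  elim: L' s => // x [|y L'] IHL s _.
    by exists x => [|v]; rewrite inE // => /eqP->; apply: to_refl.
  have [|u Lu minu] := IHL y; first exact: mem_head.
  have /orP[xu|ux] := to_total x u.
    exists x => [|v]; first exact: mem_head.
    rewrite in_cons => /orP[/eqP->|/minu]; first exact: to_refl.
    exact: to_trans.
  exists u => [|v]; first by rewrite in_cons Lu orbT.
  by rewrite in_cons => /orP[/eqP->|/minu].
have [s Ls _] := Lb t nPt.
have [u Lu minu] := minL L s Ls.
case: (LP u Lu); apply: IH => v vu nevu; apply: NNPP => /Lb[w Lw wv].
move/eqP: nevu; apply; apply: to_anti => //.
exact: to_trans (minu w Lw) (lepm_to wv).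
Qed.

End TermOrder.

Lemma x_partD n (s t : 'X_{1..n + n}) : x_part (s + t) = (x_part s + x_part t)%MM.
Proof. by apply/mnmP => i; rewrite !(mnmE, mnmDE). Qed.

Lemma y_partD n (s t : 'X_{1..n + n}) : y_part (s + t) = (y_part s + y_part t)%MM.
Proof. by apply/mnmP => i; rewrite !(mnmE, mnmDE). Qed.

Lemma xy_part_inj n (s t : 'X_{1..n + n}) :
  x_part s = x_part t -> y_part s = y_part t -> s = t.
Proof.
move=> /mnmP exst /mnmP eyst; apply/mnmP => i.
have := splitK i; case: (split i) => j /= <-.
  by have := exst j; rewrite !mnmE.
by have := eyst j; rewrite !mnmE.
Qed.

Lemma block_order_term_order n (leX leY : rel 'X_{1..n}) :
  term_order leX -> term_order leY -> term_order (block_order leX leY).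
Proof.
move=> hX hY; rewrite /block_order; split.
- move=> s t; rewrite [x_part t == _]eq_sym.
  by case: eqP => _; apply: to_total.
- move=> s t; rewrite [x_part t == _]eq_sym; case: eqP => [exst|nexst] /andP[st ts].
    by apply: xy_part_inj => //; apply: to_anti hY _ _ st ts.
  by case: nexst; apply: to_anti hX _ _ st ts.
- move=> t s u.
  have [->|nst] := eqVneq (x_part s) (x_part t).
    by case: eqP => // _; apply: to_trans.
  have [<-|ntu] := eqVneq (x_part t) (x_part u); first by rewrite (negPf nst).
  move=> st tu; case: eqP => [esu|_]; last exact: (to_trans hX) tu.
  by case/eqP: nst; apply: (to_anti hX) => //; rewrite esu.
- move=> t; have ->: x_part (0 : 'X_{1..n + n}) = 0%MM.
    by apply/mnmP => i; rewrite !mnmE.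
  have ->: y_part (0 : 'X_{1..n + n}) = 0%MM by apply/mnmP => i; rewrite !mnmE.
  by case: eqP => _; apply: to_ge0.
- move=> s t u; rewrite !x_partD !y_partD eqm_add2r.
  by case: eqP => _; apply: to_add.
Qed.

(** * Leading terms *)

Section LeadingTermTheory.
Variables (n : nat) (le : rel 'X_{1..n}).
Hypothesis hle : term_order le.

Section Ring.
Variable R : nzRingType.
Implicit Types f g : {mpoly R[n]}.

Lemma lpp_max f t : t \in msupp f -> le t (lpp le f).
Proof.
rewrite /lpp; elim: (msupp f) => // s r IHr; rewrite in_cons big_cons.
set w := bigop _ _ _ in IHr *; case: ifP => sw /orP[/eqP->|/IHr tw] //.
  exact: to_refl.
apply: (to_trans hle) tw _; have := to_total hle s w; by rewrite sw.
Qed.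

Lemma lpp_supp f : f != 0 -> lpp le f \in msupp f.
Proof.
rewrite -msupp_eq0 /lpp; elim: (msupp f) => // s r IHr _; rewrite big_cons.
case: r IHr => [|u r] IHr.
  (* For a singleton support [s] is compared with the starting value 0, and [le s 0] forces [s] to
     be 0. *)
  rewrite big_nil; case: ifP => [s0|_]; last exact: mem_head.
  by rewrite (to_anti hle s0 (to_ge0 hle s)) mem_head.
by case: ifP => _; rewrite in_cons ?eqxx // IHr // orbT.
Qed.

Lemma lc_neq0 f : f != 0 -> lc le f != 0.
Proof. by move=> /lpp_supp; rewrite mcoeff_msupp. Qed.

Lemma lc_neq0_inv f : lc le f != 0 -> f != 0.
Proof. by apply: contra_neq => ->; rewrite /lc mcoeff0. Qed.

Lemma lpp_eq f t :
  t \in msupp f -> (forall s, s \in msupp f -> le s t) -> lpp le f = t.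
Proof.
move=> ft maxt; apply: (to_anti hle); last exact: lpp_max.
by apply/maxt/lpp_supp; rewrite -msupp_eq0; case: (msupp f) ft.
Qed.

Lemma msupp_mulX f t u :
  u \in msupp ('X_[t] * f) -> exists2 s, s \in msupp f & u = (t + s)%MM.
Proof.
rewrite -(commr_mpolyX t f) (perm_mem (msuppMX f t)) => /mapP[s fs ->].
by exists s => //; rewrite addmC.
Qed.

(** One division step. It is the decrease used both for generation by a Groebner basis and for
    termination of the division. *)
Lemma msupp_cancel f (c : R) (t : 'X_{1..n}) g : f != 0 -> g != 0 ->
  (lpp le f = t + lpp le g)%MM -> c * lc le g = lc le f ->
  forall u, u \in msupp (f - c *: ('X_[t] * g)) ->
  le u (lpp le f) && (u != lpp le f).
Proof.
move=> f0 g0 eft ec u fu; apply/andP; split; last first.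
  apply: contraTneq fu => ->; rewrite -mcoeff_eq0 mcoeffB mcoeffZ.
  rewrite -(commr_mpolyX t g) eft mcoeffMX -eft.
  by rewrite -/(lc le f) -/(lc le g) ec subrr.
have := msuppB_le fu; rewrite mem_cat => /orP[/lpp_max //|/msuppZ_le].
move=> /msupp_mulX[s gs ->]; rewrite eft ![(t + _)%MM]addmC.
by apply/to_add/lpp_max.
Qed.

Lemma msupp_sub_lterm f : f != 0 ->
  forall u, u \in msupp (f - lterm le f) ->
  [&& u \in msupp f, le u (lpp le f) & u != lpp le f].
Proof.
move=> f0 u; rewrite mcoeff_msupp mcoeffB /lterm mcoeffZ mcoeffX.
have [<-|neu] := eqVneq (lpp le f) u.
  by rewrite mulr1 -/(lc le f) subrr eqxx.
rewrite mulr0 subr0 -mcoeff_msupp => fu.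
by rewrite fu lpp_max // eq_sym neu.
Qed.

End Ring.

(** Serves three maps of coefficients: specialization at a point, passage to fractions, and
    inclusion of constants. *)
Lemma lpp_map (R S : nzRingType) (phi : {additive R -> S}) (f : {mpoly R[n]}) :
  phi (lc le f) != 0 -> lpp le (map_mpoly phi f) = lpp le f.
Proof.
move=> phif; apply: lpp_eq => [|s].
  by rewrite mcoeff_msupp mcoeff_map_mpoly.
rewrite mcoeff_msupp mcoeff_map_mpoly => phis; apply: lpp_max.
by rewrite mcoeff_msupp; apply: contra_neq phis => ->; rewrite raddf0.
Qed.

Lemma lc_map (R S : nzRingType) (phi : {additive R -> S}) (f : {mpoly R[n]}) :
  phi (lc le f) != 0 -> lc le (map_mpoly phi f) = phi (lc le f).
Proof. by move=> phif; rewrite /lc lpp_map // mcoeff_map_mpoly. Qed.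

End LeadingTermTheory.

(** * Groebner bases and the parametric division algorithm *)

Section GroebnerBases.
Variables (n : nat) (le : rel 'X_{1..n}) (k : fieldType).
Hypothesis hle : term_order le.
Implicit Types (I : {mpoly k[n]} -> Prop) (G : {fset {mpoly k[n]}}).

Lemma idealZ I (c : k) f : is_ideal I -> I f -> I (c *: f).
Proof. by move=> idI If; rewrite -mul_mpolyC; apply: idealM. Qed.

Lemma idealZ_inv I (c : k) f : is_ideal I -> c != 0 -> I (c *: f) -> I f.
Proof.
by move=> idI c0 /(idealZ c^-1 idI); rewrite scalerA mulVf // scale1r.
Qed.

(** Cancelling the leading term of [f] by a multiple of a basis element stays in [I] and lowers the
    leading monomial, so [to_ind] applies. *)
Lemma groebner_generates I G f :
  is_ideal I -> groebner_basis le I G -> I f -> ideal_gen G f.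
Proof.
move=> idI [G0 GI Glpp]; have idG := ideal_gen_is_ideal G.
have [t] := ex_intro (fun t => lpp le f = t) _ erefl.
elim/(to_ind hle): t f => t IHt f eft If.
have [->|f0] := eqVneq f 0; first exact: ideal0.
have [g Gg gf] := Glpp f If f0; have g0 := G0 g Gg.
set c := lc le f / lc le g; pose h := 'X_[(lpp le f - lpp le g)%MM] * g.
rewrite -[f](subrK (c *: h)); apply: idealD => //; last first.
  by apply: idealZ => //; apply: idealM => //; apply: mem_ideal_gen.
have Ifh : I (f - c *: h).
  by apply: idealB => //; apply: idealZ => //; apply: idealM => //; apply: GI.
have [->|fh0] := eqVneq (f - c *: h) 0; first exact: ideal0.
have /andP[] : le (lpp le (f - c *: h)) (lpp le f)
            && (lpp le (f - c *: h) != lpp le f).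
  apply: (msupp_cancel hle f0 g0 _ _ (lpp_supp hle fh0)).
    by rewrite submK.
  by rewrite divfK // lc_neq0.
by rewrite eft => ltt net; apply: IHt (ltt) net _ erefl Ifh.
Qed.

Lemma groebner_basisE I G f : is_ideal I -> groebner_basis le I G ->
  ideal_gen G f <-> I f.
Proof.
move=> idI gbG; split; last exact: groebner_generates.
by case: gbG => _ GI _; apply: ideal_gen_least.
Qed.

Lemma groebner_reduced_eq0 I G f : groebner_basis le I G ->
  (forall t g, t \in msupp f -> g \in G -> ~~ (lpp le g <= t)%MM) ->
  I f -> f = 0.
Proof.
move=> [_ _ Glpp] red If; apply/eqP; apply: contraT => f0.
have [g Gg] := Glpp f If f0.
by rewrite (negPf (red _ _ (lpp_supp hle f0) Gg)).
Qed.

(** Dickson's lemma is applied to the leading monomials of [I], and one polynomial is chosen for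
    each monomial kept. Together with [groebner_generates] this stands in for Hilbert's basis
    theorem. *)
Lemma minimal_groebner_basis_exists I :
  exists G, minimal_groebner_basis le I G.
Proof.
have [L [LP Lb Lmin]] :=
  dickson (fun t => exists f, [/\ I f, f != 0 & lpp le f = t]).
have [h hP] := finite_choice 0 LP.
exists [fset h t | t in L]; split; first split.
- by move=> _ /imfsetP[t /= Lt ->]; case: (hP t Lt).
- by move=> _ /imfsetP[t /= Lt ->]; case: (hP t Lt).
- move=> f If f0; have [|s Ls sf] := Lb (lpp le f); first by exists f.
  by exists (h s); [apply: in_imfset | case: (hP s Ls) => _ _ ->].
- move=> _ _ /imfsetP[s /= Ls ->] /imfsetP[t /= Lt ->].
  have [_ _ ->] := hP s Ls; have [_ _ ->] := hP t Lt.
  by apply: contraNN => /(Lmin s t Ls Lt) ->.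
Qed.

End GroebnerBases.

(** * Specialization of the parameters at a point *)

Section Specialization.
Variables (K : finFieldType) (m n : nat).
Implicit Types (a : point K m) (F : {fset {mpoly {mpoly K[m]}[n]}}).
Implicit Types (f : {mpoly {mpoly K[m]}[n]}).

HB.instance Definition _ a :=
  GRing.RMorphism.copy (@specialize K m n a) (map_mpoly (meval a)).

Lemma specializeZ a c f : specialize a (c *: f) = c.@[a] *: specialize a f.
Proof. exact: map_mpolyZ. Qed.

Lemma specializeX a t :
  specialize a ('X_[t] : {mpoly {mpoly K[m]}[n]}) = 'X_[t].
Proof. exact: map_mpolyX. Qed.

Lemma mcoeff_specialize a f t : (specialize a f)@_t = (f@_t).@[a].
Proof. exact: mcoeff_map_mpoly. Qed.

Lemma special_ideal_is_ideal a F : is_ideal (special_ideal a F).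
Proof. exact: ideal_gen_is_ideal. Qed.

Lemma mem_specialize_set a F f : f \in F -> specialize a f \in specialize_set a F.
Proof. exact: in_imfset. Qed.

Lemma mem_special_ideal a F f : f \in F -> special_ideal a F (specialize a f).
Proof. by move/(mem_specialize_set a); apply: mem_ideal_gen. Qed.

Lemma special_ideal_least a F (I : {mpoly K[n]} -> Prop) (f : {mpoly K[n]}) :
  is_ideal I ->
  (forall g, g \in F -> I (specialize a g)) -> special_ideal a F f -> I f.
Proof.
move=> idI FI; apply: ideal_gen_least => // _ /imfsetP[g /= Fg ->].
exact: FI.
Qed.

Lemma specialize_ideal_gen a F f :
  ideal_gen F f -> special_ideal a F (specialize a f).
Proof.
apply: ideal_gen_rmorph; first exact: special_ideal_is_ideal.
exact: mem_special_ideal.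
Qed.

Variables (le : rel 'X_{1..n}).
Hypothesis hle : term_order le.

Lemma lpp_specialize a f :
  (lc le f).@[a] != 0 -> lpp le (specialize a f) = lpp le f.
Proof. exact: (@lpp_map _ _ hle _ _ (meval a)). Qed.

Lemma lc_specialize a f :
  (lc le f).@[a] != 0 -> lc le (specialize a f) = (lc le f).@[a].
Proof. exact: (@lc_map _ _ hle _ _ (meval a)). Qed.

End Specialization.

(** * Division over F_q(U) and the control of its denominators *)

Section Division.
Variables (K : finFieldType) (m n : nat) (le : rel 'X_{1..n}).
Hypothesis hle : term_order le.
Variable G : {fset {mpoly {mpoly K[m]}[n]}}.
Local Notation coef := {mpoly K[m]}.
Local Notation pol := {mpoly {mpoly K[m]}[n]}.
Local Notation fpol := {mpoly {fraction {mpoly K[m]}}[n]}.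
Implicit Types (d : coef) (f g h w : pol) (p r : fpol).

HB.instance Definition _ :=
  GRing.RMorphism.copy (@to_fpol K m n) (map_mpoly (@tofrac _)).

Lemma to_fpolZ d f : to_fpol (d *: f) = tofrac d *: to_fpol f.
Proof. exact: map_mpolyZ. Qed.

Lemma to_fpolX t : to_fpol ('X_[t] : pol) = 'X_[t].
Proof. exact: map_mpolyX. Qed.

Lemma mcoeff_to_fpol f t : (to_fpol f)@_t = tofrac f@_t.
Proof. exact: mcoeff_map_mpoly. Qed.

Lemma to_fpol_inj : injective (@to_fpol K m n).
Proof.
move=> f g efg; apply/mpolyP => t; apply/eqP.
by rewrite -tofrac_eq -!mcoeff_to_fpol efg.
Qed.

Lemma msupp_to_fpol f t : (t \in msupp (to_fpol f)) = (t \in msupp f).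
Proof. by rewrite !mcoeff_msupp mcoeff_to_fpol tofrac_eq0. Qed.

Lemma to_fpol_neq0 f : f != 0 -> to_fpol f != 0.
Proof. by apply: contra_neq => f0; apply: to_fpol_inj; rewrite f0 raddf0. Qed.

Lemma lpp_to_fpol f : f != 0 -> lpp le (to_fpol f) = lpp le f.
Proof.
by move=> f0; apply: (lpp_map (phi := @tofrac coef) hle);
  rewrite tofrac_eq0 lc_neq0.
Qed.

Lemma lc_to_fpol f : f != 0 -> lc le (to_fpol f) = tofrac (lc le f).
Proof.
by move=> f0; apply: (lc_map (phi := @tofrac coef) hle);
  rewrite tofrac_eq0 lc_neq0.
Qed.

(* An abstract stand-in for the products of leading coefficients of [G]. *)
Definition denominator d : Prop := d != 0 /\
  forall a : point K m, (forall g, g \in G -> (lc le g).@[a] != 0) ->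
    d.@[a] != 0.

Lemma denominator1 : denominator 1.
Proof.
by split=> [|a _]; rewrite ?oner_eq0 // rmorph1 oner_eq0.
Qed.

Lemma denominatorM d1 d2 :
  denominator d1 -> denominator d2 -> denominator (d1 * d2).
Proof.
move=> [d10 d1G] [d20 d2G]; split=> [|a Ga]; first by rewrite mulf_neq0.
by rewrite rmorphM mulf_neq0 ?d1G ?d2G.
Qed.

Lemma denominator_lc g : g \in G -> g != 0 -> denominator (lc le g).
Proof. by move=> Gg g0; split=> [|a]; [apply: lc_neq0 | apply]. Qed.

(** Reducing and shifting both remove the leading term of the dividend and add only smaller ones. *)
Lemma division_exists p : exists r, division le G p r.
Proof.
have [t] := ex_intro (fun t => lpp le p = t) _ erefl.
elim/(to_ind hle): t p => t IHt p ept.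
have [->|p0] := eqVneq p 0; first by exists 0; apply: division_stop.
have step q : (forall u, u \in msupp q -> le u (lpp le p) && (u != lpp le p)) ->
    exists r, division le G q r.
  move=> ltq; have [->|q0] := eqVneq q 0; first by exists 0; apply: division_stop.
  have /andP[] := ltq _ (lpp_supp hle q0).
  by rewrite ept => ltt net; apply: IHt ltt net _ erefl.
case: (classic (exists g, [/\ g \in G, g != 0 & (lpp le (to_fpol g) <= lpp le p)%MM])).
  case=> g [Gg g0 gp]; have [|r divr] := step (p -
    (lc le p / lc le (to_fpol g)) *:
      ('X_[(lpp le p - lpp le (to_fpol g))%MM] * to_fpol g)).
    apply: msupp_cancel => //; first exact: to_fpol_neq0.
      by rewrite submK.
    by rewrite divfK // lc_neq0 // to_fpol_neq0.
  by exists r; apply: division_reduce divr.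
move=> nog; have [|r divr] := step (p - lterm le p).
  by move=> u /(msupp_sub_lterm hle p0) /and3P[_ -> ->].
exists (lterm le p + r); apply: division_shift => // g Gg g0.
by apply/negP => gp; case: nog; exists g.
Qed.

Lemma division_reduced p r : division le G p r ->
  forall t g, t \in msupp r -> g \in G -> g != 0 ->
    ~~ (lpp le (to_fpol g) <= t)%MM.
Proof.
elim=> {p r} [t g|//|p r p0 red _ IH t g].
  by rewrite mcoeff_msupp mcoeff0 eqxx.
move=> /msuppD_le; rewrite mem_cat => /orP[/msuppZ_le|]; last exact: IH.
by rewrite msuppX inE => /eqP ->; apply: red.
Qed.

(** A run of the division is an identity over F_q(U); here it is cleared to one over F_q[U], which
    can be specialized. Allowing a dividend [p] already cleared by [d0] keeps the induction going,
    since each reduction step multiplies the denominator by one leading coefficient. *)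
Lemma division_cleared p r d0 f : division le G p r ->
  denominator d0 -> to_fpol f = tofrac d0 *: p ->
  exists d w, [/\ denominator d, ideal_gen G w
    & to_fpol w = tofrac d *: (p - r)].
Proof.
have idG := ideal_gen_is_ideal G.
move=> divr; elim: divr d0 f => {p r} [|p r g p0 Gg g0 gp _ IH|p r p0 _ _ IH] d0 f.
- move=> _ _; exists 1, 0; split; [exact: denominator1 | exact: ideal0 |].
  by rewrite rmorph0 subr0 scaler0.
- move=> dd0 efp; have dg := denominator_lc Gg g0.
  set t := (lpp le p - lpp le (to_fpol g))%MM in IH *.
  have d00 : tofrac d0 != 0 by rewrite tofrac_eq0; case: dd0.
  have lg0 : tofrac (lc le g) != 0 by rewrite tofrac_eq0 lc_neq0.
  (* After clearing, the quotient coefficient of this step is a coefficient of [f], hence a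
     polynomial in the parameters. *)
  have elp : tofrac (d0 * lc le g) * (lc le p / lc le (to_fpol g)) =
             tofrac f@_(lpp le p).
    rewrite -mcoeff_to_fpol efp mcoeffZ lc_to_fpol // rmorphM -/(lc le p).
    by rewrite mulrACA divff // mulr1.
  pose u := f@_(lpp le p) *: ('X_[t] * g).
  have eu : to_fpol u = tofrac (d0 * lc le g) *:
      ((lc le p / lc le (to_fpol g)) *: ('X_[t] * to_fpol g)).
    by rewrite scalerA elp to_fpolZ rmorphM /= to_fpolX.
  have Gu : ideal_gen G u.
    rewrite /u -mul_mpolyC; apply: idealM => //; apply: idealM => //.
    exact: mem_ideal_gen.
  (* Hides the body of [u]; only its image and its membership matter from here on. *)
  move: u eu Gu => u eu Gu.
  have [||d [w [dd Gw ew]]] := IH (d0 * lc le g) (lc le g *: f - u).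
  + exact: denominatorM.
  + rewrite rmorphB /= eu to_fpolZ efp scalerBr scalerA.
    by rewrite [d0 * _]mulrC rmorphM.
  exists (d * (d0 * lc le g)), ((d0 * lc le g) *: w + d *: u); split.
  + by apply: denominatorM => //; apply: denominatorM.
  + by apply: idealD => //; rewrite -mul_mpolyC; apply: idealM.
  + rewrite rmorphD /= !to_fpolZ eu ew [tofrac (d * _)]rmorphM /=.
    move: (_ *: (_ * _)) => x; rewrite scalerA [X in X *: _ + _]mulrC.
    by rewrite -!scalerA -!scalerDr addrAC subrK.
- move=> dd0 efp; have [||d [w [dd Gw ew]]] := IH d0 (f - f@_(lpp le p) *: 'X_[lpp le p]).
  + exact: dd0.
  + rewrite rmorphB /= to_fpolZ to_fpolX scalerBr efp -mcoeff_to_fpol efp.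
    by rewrite mcoeffZ /lterm scalerA.
  by exists d, w; rewrite ew opprD addrA.
Qed.

End Division.

Section ParametricRemainder.
Variables (K : finFieldType) (m n : nat) (le : rel 'X_{1..n}).
Hypothesis hle : term_order le.
Implicit Types (s : segment K m n) (f h : {mpoly {mpoly K[m]}[n]}).

Lemma prem_exists s f :
  (forall a g, a \in seg_locus s -> g \in seg_G s -> (lc le g).@[a] != 0) ->
  exists h, is_prem le s f h.
Proof.
move=> lcs; have [r divr] := division_exists hle (seg_G s) (to_fpol f).
have ef : to_fpol f = tofrac 1 *: to_fpol f by rewrite rmorph1 scale1r.
have [d [w [[d0 dG] _ ew]]] := division_cleared hle divr (denominator1 le _) ef.
(* As [w] maps to d(f - r), the witness maps to d r. *)
exists (d *: f - w), r, d; split=> // [a sa|].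
  by apply: dG => g; apply: lcs.
by rewrite rmorphB /= to_fpolZ ew -scalerBr opprB addrC subrK.
Qed.

(* A Groebner basis detects membership by its remainders, and the
   parametric remainder specializes to a multiple of a remainder. *)
Lemma prem_specialize s f h a : a \in seg_locus s ->
  (forall g, g \in seg_G s -> (lc le g).@[a] != 0) ->
  groebner_basis le (special_ideal a (seg_G s)) (specialize_set a (seg_G s)) ->
  is_prem le s f h ->
  specialize a h = 0 <-> special_ideal a (seg_G s) (specialize a f).
Proof.
move=> sa lcs gbs [r [c [divr c0 /(_ a sa) ca er]]].
have ef : to_fpol f = tofrac 1 *: to_fpol f by rewrite rmorph1 scale1r.
have [d [w [[d0 /(_ a lcs) da] Gw ew]]] :=
  division_cleared hle divr (denominator1 le _) ef.
have idI := special_ideal_is_ideal a (seg_G s).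
(* The remainder [r] has no value at [a], so it is eliminated between h = c r and w = d(f - r). *)
have ecw : c *: w = (d * c) *: f - d *: h.
  apply: to_fpol_inj; rewrite rmorphB /= !to_fpolZ ew er rmorphM.
  by rewrite scalerBr scalerBr !scalerA [tofrac c * _]mulrC.
have Iw : special_ideal a (seg_G s)
    ((d * c).@[a] *: specialize a f - d.@[a] *: specialize a h).
  rewrite -!specializeZ -rmorphB -ecw /= specializeZ.
  by apply: idealZ => //; apply: specialize_ideal_gen.
have dca : (d * c).@[a] != 0 by rewrite rmorphM mulf_neq0.
split=> [h0|If].
  by move: Iw; rewrite h0 scaler0 subr0; apply: idealZ_inv.
(* Every monomial of the specialized [h] already occurs in [r], where it is reduced; the divisors
   keep their leading monomials at [a]. *)
apply: (groebner_reduced_eq0 hle gbs) => [t _ ht /imfsetP[g /= Gg ->]|].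
  have g0 : g != 0.
    by apply: (@lc_neq0_inv _ le); apply: contra_neq (lcs g Gg) => ->; rewrite rmorph0.
  rewrite lpp_specialize ?lcs // -(lpp_to_fpol hle) //.
  apply: (division_reduced divr) => //.
  apply: (@msuppZ_le _ _ (tofrac c)); rewrite -er msupp_to_fpol.
  move: ht; rewrite !mcoeff_msupp mcoeff_specialize.
  by apply: contra_neq => ->; rewrite meval0.
apply: (idealZ_inv idI da).
have := idealB idI (idealZ (d * c).@[a] idI If) Iw.
by rewrite opprB addrC subrK.
Qed.

End ParametricRemainder.

(** * Congruences between substitutions, and the Frobenius map *)

Section Congruence.
Variables (R S : comNzRingType) (n : nat) (I : S -> Prop).
Hypothesis idI : is_ideal I.

Lemma ideal_congrM (x x' y y' : S) : I (x - x') -> I (y - y') -> I (x * y - x' * y').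
Proof.
move=> Ix Iy; have -> : x * y - x' * y' = x * (y - y') + y' * (x - x').
  by rewrite !mulrBr [y' * x]mulrC [y' * x']mulrC addrA subrK.
by apply: idealD => //; apply: idealM.
Qed.

(** Two substitutions that agree on constants and variables modulo an ideal agree everywhere modulo
    it. It yields the Frobenius identity, evaluation at a point, and the rule y = x^q in the graph
    ideal. *)
Lemma mpoly_congr (phi psi : {rmorphism {mpoly R[n]} -> S}) :
  (forall c, I (phi c%:MP - psi c%:MP)) -> (forall i, I (phi 'X_i - psi 'X_i)) ->
  forall f, I (phi f - psi f).
Proof.
move=> IC IX f; rewrite [f]mpolyE !rmorph_sum -sumrB.
apply: ideal_sum => // t _; rewrite -mul_mpolyC !rmorphM.
apply: ideal_congrM => //; rewrite mpolyXE_id !rmorph_prod.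
elim: (index_enum _) => [|i r IHr]; first by rewrite !big_nil subrr; apply: ideal0.
rewrite !big_cons; apply: ideal_congrM => //; rewrite !rmorphXn.
elim: (t i) => [|e IHe]; first by rewrite !expr0 subrr; apply: ideal0.
by rewrite !exprS; apply: ideal_congrM.
Qed.

End Congruence.

Lemma mpoly_rmorph_eq (R S : comNzRingType) n (phi psi : {rmorphism {mpoly R[n]} -> S}) :
  (forall c, phi c%:MP = psi c%:MP) -> (forall i, phi 'X_i = psi 'X_i) ->
  phi =1 psi.
Proof.
move=> eC eX f; apply/eqP; rewrite -subr_eq0; apply/eqP.
have id0 : is_ideal (fun x : S => x = 0).
  by split=> // [x y -> ->|c x ->]; rewrite ?addr0 ?mulr0.
by apply: (mpoly_congr id0) => [c|i]; rewrite ?eC ?eX subrr.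
Qed.

Section Frobenius.
Variables (K : finFieldType) (n : nat).

Lemma card_field_gt0 : (0 < #|K|)%N.
Proof. by apply/card_gt0P; exists 0. Qed.

Lemma expf_cardD (f g : {mpoly K[n]}) : (f + g) ^+ #|K| = f ^+ #|K| + g ^+ #|K|.
Proof.
have [p p_pr charKp] := finPcharP K; apply: exprDn_pchar.
(* As a vector space over its prime field, [K] has p-power cardinality. *)
rewrite -[#|_|]/#|pPrimeCharType charKp| card_pprimeChar.
by rewrite pnatX pnatE // (rmorph_pchar (@mpolyC n K)).
Qed.

Lemma expf_cardN (f : {mpoly K[n]}) : (- f) ^+ #|K| = - f ^+ #|K|.
Proof.
apply/eqP; rewrite -subr_eq0 opprK -expf_cardD addNr.
by rewrite expr0n gtn_eqF // card_field_gt0.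
Qed.

Lemma expf_cardB (f g : {mpoly K[n]}) : (f - g) ^+ #|K| = f ^+ #|K| - g ^+ #|K|.
Proof. by rewrite expf_cardD expf_cardN. Qed.

(** Named in order to carry a ring morphism structure, as [ideal_preim] and [mpoly_congr]
    require. *)
Definition frobenius (f : {mpoly K[n]}) := f ^+ #|K|.

Fact frobenius_is_zmod_morphism : zmod_morphism frobenius.
Proof. by move=> f g; apply: expf_cardB. Qed.

Fact frobenius_is_monoid_morphism : monoid_morphism frobenius.
Proof. by split=> [|f g]; rewrite /frobenius ?expr1n ?exprMn. Qed.

HB.instance Definition _ := GRing.isZmodMorphism.Build _ _ frobenius
  frobenius_is_zmod_morphism.
HB.instance Definition _ := GRing.isMonoidMorphism.Build _ _ frobenius
  frobenius_is_monoid_morphism.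

Lemma frobenius_iter N (f : {mpoly K[n]}) : f ^+ (#|K| ^ N) = iter N frobenius f.
Proof.
by elim: N => [|N IHN]; rewrite ?expr1 //= -IHN /frobenius -exprM expnSr.
Qed.

End Frobenius.

(** * The Nullstellensatz over a finite field *)

Section Nullstellensatz.
Variables (K : finFieldType) (m : nat).
Implicit Types (a : point K m) (E : {fset {mpoly K[m]}}) (f : {mpoly K[m]}).

Definition field_equations : {fset {mpoly K[m]}} :=
  [fset 'X_i ^+ #|K| - 'X_i | i in 'I_m].

(** The Lagrange function of [a]: since c^(q-1) is 1 for nonzero c and 0 for c = 0, its value is 1
    at [a] and 0 at every other point. *)
Definition point_indicator a : {mpoly K[m]} :=
  \prod_i (1 - ('X_i - (a i)%:MP) ^+ #|K|.-1).

(** The difference of the two sides has degree below q and vanishes at all q elements of [K]. Root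
    counting dictates the univariate setting. *)
Lemma sum_lagrange : \sum_(b : K) (1 - ('X - b%:P) ^+ #|K|.-1) = 1 :> {poly K}.
Proof.
apply/eqP; rewrite -subr_eq0; apply/eqP.
have q1 : (0 < #|K|.-1)%N by rewrite -ltnS prednK ?card_field_gt0 ?finNzRing_gt1.
apply: (@roots_geq_poly_eq0 _ _ (enum K)); last first.
- rewrite -cardE; have szb (b : K) : (size (1 - ('X - b%:P) ^+ #|K|.-1)%R <= #|K|)%N.
    apply: leq_trans (size_polyD _ _) _; rewrite size_polyN size_exp_XsubC.
    by rewrite prednK ?card_field_gt0 // geq_max leqnn size_poly1 card_field_gt0.
  apply: leq_trans (size_polyD _ _) _.
  rewrite size_polyN size_poly1 geq_max card_field_gt0 andbT.
  by apply: (big_ind (fun p : {poly K} => size p <= #|K|)%N);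
    rewrite ?size_poly0 // => p r sp sr; apply: leq_trans (size_polyD _ _) _;
    rewrite geq_max sp.
- exact: enum_uniq.
apply/allP => x _; rewrite rootE hornerD hornerN hornerC horner_sum (bigD1 x) //=.
rewrite big1 ?addr0 => [|b nebx]; rewrite !hornerE.
  by rewrite subrr expr0n gtn_eqF // subr0 subrr.
have xb0 : x - b != 0 by rewrite subr_eq0 eq_sym.
suff -> : (x - b) ^+ #|K|.-1 = 1 by rewrite subrr.
by apply: (mulfI xb0); rewrite -exprS prednK ?card_field_gt0 // expf_card mulr1.
Qed.

(** Distributing the product over coordinates turns the sum over points into a product of univariate
    sums, each equal to 1 by [sum_lagrange]. *)
Lemma sum_point_indicator : \sum_a point_indicator a = 1.
Proof.
rewrite /point_indicator -(bigA_distr_bigA (fun i b =>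
  1 - ('X_i - b%:MP) ^+ #|K|.-1 : {mpoly K[m]})) /= big1 // => i _.
have cX : commr_rmorph (@mpolyC m K) 'X_i by move=> c; apply: mulrC.
have := congr1 (horner_morph cX) sum_lagrange.
rewrite rmorph1 rmorph_sum; apply: etrans; apply: eq_bigr => b _.
rewrite rmorphB rmorph1 rmorphXn rmorphB /=.
by rewrite horner_morphX horner_morphC.
Qed.

Section PointIndicator.
Variables (J : {mpoly K[m]} -> Prop).
Hypotheses (idJ : is_ideal J) (fieldJ : forall i, J ('X_i ^+ #|K| - 'X_i)).

(** With z = X_i - a_i, the product z(1 - z^(q-1)) = z - z^q equals X_i - X_i^q, because a_i^q =
    a_i. *)
Lemma point_indicatorX a i : J (('X_i - (a i)%:MP) * point_indicator a).
Proof.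
rewrite /point_indicator (bigD1 i) //= mulrA [_ * (1 - _)]mulrC.
rewrite mulrBl mul1r -exprSr prednK ?card_field_gt0 // expf_cardB.
rewrite -(rmorphXn (@mpolyC m K)) /= expf_card mulrC; apply: idealM => //.
rewrite opprB addrA subrK -opprB; exact: idealN.
Qed.

(** The multipliers of the indicator into [J] form an ideal, modulo which the identity and
    evaluation at [a] agree on the variables. *)
Lemma point_indicator_congr a f : J ((f - f.@[a]%:MP) * point_indicator a).
Proof.
have idJa : is_ideal (fun g => J (g * point_indicator a)).
  split=> [|g h Jg Jh|c g Jg]; rewrite ?mul0r ?mulrDl -?mulrA.
  - exact: ideal0.
  - exact: idealD.
  - exact: idealM.
apply: (mpoly_congr idJa (phi := idfun)
  (psi := (@mpolyC m K \o meval a : {rmorphism _ -> _}))) => [c|i] /=.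
  by rewrite mevalC subrr mul0r; apply: ideal0.
by rewrite mevalXU; apply: point_indicatorX.
Qed.

End PointIndicator.

Lemma zerosP E a : reflect (forall g, g \in E -> g.@[a] = 0) (a \in zeros E).
Proof.
rewrite inE; apply: (iffP allP) => [E0 g /E0 /eqP //|E0 g /E0 ->]; exact: eqxx.
Qed.

(** Write f as the sum of f d over the indicators d of the points a. Modulo the field equations f d
    is f(a) d, which is 0 at a zero of [E]; at any other point some e in [E] has e(a) nonzero, and e
    d = e(a) d modulo [J] puts d itself in [J]. *)
Lemma finite_nullstellensatz E f :
  (forall a, a \in zeros E -> f.@[a] = 0) <->
  ideal_gen (E `|` field_equations) f.
Proof.
set J := ideal_gen _; have idJ : is_ideal J by apply: ideal_gen_is_ideal.
have fieldJ i : J ('X_i ^+ #|K| - 'X_i).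
  by apply: mem_ideal_gen; rewrite inE; apply/orP; right; apply: in_imfset.
split=> [f0|Jf a Ea]; last first.
  have idA : is_ideal (fun g : {mpoly K[m]} => g.@[a] = 0).
    split=> [|g h g0 h0|c g g0]; rewrite ?meval0 ?mevalD ?mevalM ?g0 ?h0 //.
      by rewrite addr0.
    by rewrite mulr0.
  apply: (ideal_gen_least idA _ Jf) => g; rewrite inE => /orP[Eg|].
    exact: (zerosP _ _ Ea).
  case/imfsetP=> i /= _ ->.
  by rewrite mevalB (rmorphXn (meval a)) /= mevalXU expf_card subrr.
rewrite -[f]mulr1 -sum_point_indicator big_distrr /=.
apply: ideal_sum => // a _; set d := point_indicator a.
have congrd g := point_indicator_congr idJ fieldJ a g.
have [/f0 fa|] := boolP (a \in zeros E); last first.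
  rewrite inE => /allPn[e Ee ea].
  suff Jd : J d by apply: idealM.
  have : J (e * d - (e - e.@[a]%:MP) * d).
    apply: idealB => //; rewrite mulrC; apply: idealM => //.
    by apply: mem_ideal_gen; rewrite inE Ee.
  rewrite -mulrBl opprB addrC subrK mul_mpolyC.
  exact: idealZ_inv.
by have := congrd f; rewrite fa mpolyC0 subr0.
Qed.

End Nullstellensatz.

(** * Correctness of the emptiness test *)

Section Emptiness.
Variables (K : finFieldType) (m n : nat).
Implicit Types (s : segment K m n).

Lemma in_seg_locus s a :
  (a \in seg_locus s) = (a \in zeros (seg_E s)) && (a \notin zeros (seg_N s)).
Proof. by rewrite finset.in_setD andbC. Qed.

Lemma IsEmptyLCS_locus s :
  IsEmptyLCS (seg_E s) (seg_N s) <-> seg_locus s = finset.set0.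
Proof.
split=> [empty|locus0 g Ng].
  apply/setP => a; rewrite finset.in_set0 in_seg_locus.
  apply/negP => /andP[Ea] /negP; apply; apply/zerosP => g /empty.
  by move/finite_nullstellensatz; apply.
apply/finite_nullstellensatz => a Ea.
have : a \notin seg_locus s by rewrite locus0 finset.in_set0.
by rewrite in_seg_locus Ea /= negbK => /zerosP; apply.
Qed.

Lemma nonempty_testP s : nonempty_test s <-> seg_locus s != finset.set0.
Proof.
split=> [ne|/eqP ne /IsEmptyLCS_locus //].
by apply/eqP => /IsEmptyLCS_locus.
Qed.

End Emptiness.

(** * Existence of comprehensive Groebner systems *)

Section CGSExistence.
Variables (K : finFieldType) (m n : nat) (le : rel 'X_{1..n}).
Hypothesis hle : term_order le.
Variable F : {fset {mpoly {mpoly K[m]}[n]}}.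

Definition constant_family (f : {mpoly K[n]}) : {mpoly {mpoly K[m]}[n]} :=
  map_mpoly (@mpolyC m K) f.

Lemma constant_familyK (a : point K m) : cancel constant_family (specialize a).
Proof.
by move=> f; apply/mpolyP => t; rewrite mcoeff_specialize mcoeff_map_mpoly mevalC.
Qed.

Lemma lc_constant_family f : f != 0 -> lc le (constant_family f) = (lc le f)%:MP.
Proof.
by move=> f0; apply: (lc_map hle); rewrite mpolyC_eq0; apply: lc_neq0.
Qed.

(** At a single point a basis over F_q can be lifted with constant coefficients, so its leading
    coefficients cannot vanish. *)
Lemma pointwise_basis_exists (a : point K m) :
  exists G : {fset {mpoly {mpoly K[m]}[n]}},
    [/\ forall g, g \in G -> (lc le g).@[a] != 0,
        exists2 f, special_ideal a F f & f != 0
      & minimal_groebner_basis le (special_ideal a F) (specialize_set a G)]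
    \/ (G = [fset 0] /\ forall f, special_ideal a F f -> f = 0).
Proof.
case: (classic (exists2 f, special_ideal a F f & f != 0)) => [nz|z]; last first.
  exists [fset 0]; right; split=> // f If; apply/eqP; apply: contraT => f0.
  by case: z; exists f.
have [G gbG] := minimal_groebner_basis_exists le (special_ideal a F).
have eG : specialize_set a [fset constant_family g | g in G] = G.
  apply/fsetP => g; apply/imfsetP/idP => [[_ /imfsetP[h /= Gh ->] ->]|Gg].
    by rewrite constant_familyK.
  by exists (constant_family g); rewrite ?constant_familyK ?in_imfset.
exists [fset constant_family g | g in G]; left; split; rewrite ?eG //.
move=> _ /imfsetP[g /= Gg ->]; have [[/(_ g Gg) g0 _ _] _] := gbG.
by rewrite lc_constant_family // mevalC lc_neq0.
Qed.

(** The set [[fset 1]] has no zeros, so nothing is removed from the point. *)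
Definition point_segment (a : point K m) G : segment K m n :=
  ([fset 'X_i - (a i)%:MP | i in 'I_m], [fset 1], G).

Lemma point_segment_locus a G : seg_locus (point_segment a G) = [set a]%SET.
Proof.
apply/setP => b; rewrite in_seg_locus finset.in_set1; apply/andP/eqP => [[/zerosP E0 _]|->].
  apply/ffunP => i; apply/eqP; rewrite -subr_eq0 -[b i](mevalXU b).
  by rewrite -(mevalC b (a i)) -mevalB E0 //; apply: in_imfset.
split; first by apply/zerosP => _ /imfsetP[i /= _ ->]; rewrite mevalB mevalXU mevalC subrr.
apply/negP => /zerosP /(_ 1); rewrite in_fset1 eqxx => /(_ isT) /eqP.
by rewrite meval1 oner_eq0.
Qed.

(* One segment per point of the finite set [S]. *)
Lemma CGS_exists (S : {set point K m}) : exists C, is_CGS le F S C.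
Proof.
have [G GP] := finite_choice (D := predT) fset0 (fun a _ => pointwise_basis_exists a).
exists [fset point_segment a (G a) | a in S]; split; first split.
- move=> _ /imfsetP[a /= _ ->]; rewrite point_segment_locus.
  by apply/set0Pn; exists a; rewrite finset.in_set1.
- move=> _ _ /imfsetP[a /= _ ->] /imfsetP[b /= _ ->] neab.
  rewrite !point_segment_locus disjoints1 finset.in_set1.
  by apply: contra_neq neab => ->.
- move=> a; split=> [Sa|[_ /imfsetP[b /= Sb ->]]]; last first.
    by rewrite point_segment_locus finset.in_set1 => /eqP ->.
  exists (point_segment a (G a)); first exact: in_imfset.
  by rewrite point_segment_locus finset.in_set1.
- move=> _ /imfsetP[a /= _ ->]; case: (GP a isT) => [Ga|[Ga za]]; [left|right].
    by move=> b; rewrite point_segment_locus finset.in_set1 => /eqP ->.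
  by split=> // b; rewrite point_segment_locus finset.in_set1 => /eqP ->.
Qed.

End CGSExistence.

(** * The inverse Frobenius map by elimination *)

Section YVariables.
Variable n : nat.
Implicit Types (u v : 'X_{1..n}) (t : 'X_{1..n + n}).

Definition y_embed u : 'X_{1..n + n} :=
  [multinom match split i with inl _ => 0%N | inr j => u j end | i < n + n].

Lemma y_embed_lshift u i : y_embed u (lshift n i) = 0%N.
Proof. by rewrite mnmE (unsplitK (inl i)). Qed.

Lemma y_embed_rshift u i : y_embed u (rshift n i) = u i.
Proof. by rewrite mnmE (unsplitK (inr i)). Qed.

Lemma x_part_y_embed u : x_part (y_embed u) = 0%MM.
Proof. by apply/mnmP => i; rewrite !mnmE (unsplitK (inl i)). Qed.

Lemma y_embedK : cancel y_embed (@y_part n).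
Proof. by move=> u; apply/mnmP => i; rewrite !mnmE (unsplitK (inr i)). Qed.

Lemma y_partK t : x_part t = 0%MM -> y_embed (y_part t) = t.
Proof.
by move=> t0; apply: xy_part_inj; rewrite ?y_embedK // x_part_y_embed t0.
Qed.

Lemma y_embed_lep u v : (y_embed u <= y_embed v)%MM -> (u <= v)%MM.
Proof.
move=> /mnm_lepP uv; apply/mnm_lepP => i.
by have := uv (rshift n i); rewrite !y_embed_rshift.
Qed.

Lemma x_part_eq0_lep t u : (t <= y_embed u)%MM -> x_part t = 0%MM.
Proof.
move=> /mnm_lepP tu; apply/mnmP => i; rewrite !mnmE; apply/eqP.
by have := tu (lshift n i); rewrite y_embed_lshift leqn0.
Qed.

Section Ring.
Variable R : comNzRingType.
Implicit Types (f : {mpoly R[n]}) (g : {mpoly R[n + n]}).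

HB.instance Definition _ := GRing.RMorphism.copy (@embed_X n R)
  (comp_mpoly [tuple 'X_(lshift n i) | i < n]).

HB.instance Definition _ := GRing.RMorphism.copy (@rename_Y n R)
  (comp_mpoly [tuple match split i with inl _ => 0 | inr j => 'X_j end
              | i < n + n]).

Definition embed_Y f : {mpoly R[n + n]} :=
  f \mPo [tuple 'X_(rshift n i) | i < n].

HB.instance Definition _ := GRing.RMorphism.copy embed_Y
  (comp_mpoly [tuple 'X_(rshift n i) | i < n]).

Lemma embed_XC c : embed_X (c%:MP : {mpoly R[n]}) = c%:MP.
Proof. exact: comp_mpolyC. Qed.

Lemma embed_XX i : embed_X ('X_i : {mpoly R[n]}) = 'X_(lshift n i).
Proof. by rewrite /embed_X comp_mpolyXU -tnth_nth tnth_mktuple. Qed.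

Lemma embed_YC c : embed_Y c%:MP = c%:MP.
Proof. exact: comp_mpolyC. Qed.

Lemma embed_YX i : embed_Y 'X_i = 'X_(rshift n i).
Proof. by rewrite /embed_Y comp_mpolyXU -tnth_nth tnth_mktuple. Qed.

Lemma rename_YC c : rename_Y (c%:MP : {mpoly R[n + n]}) = c%:MP.
Proof. exact: comp_mpolyC. Qed.

Lemma rename_YX i : rename_Y ('X_i : {mpoly R[n + n]}) =
  match split i with inl _ => 0 | inr j => 'X_j end.
Proof. by rewrite /rename_Y comp_mpolyXU -tnth_nth tnth_mktuple. Qed.

Lemma embed_Y_term u : embed_Y 'X_[u] = 'X_[y_embed u].
Proof.
rewrite mpolyXE_id rmorph_prod [RHS]mpolyXE_id big_split_ord /=.
rewrite [X in _ = X * _]big1 ?mul1r.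
  by apply: eq_bigr => i _; rewrite y_embed_rshift rmorphXn /= embed_YX.
by move=> i _; rewrite y_embed_lshift expr0.
Qed.

Lemma rename_Y_term t : x_part t = 0%MM ->
  rename_Y ('X_[t] : {mpoly R[n + n]}) = 'X_[y_part t].
Proof.
move=> t0; rewrite [X in rename_Y X]mpolyXE_id rmorph_prod big_split_ord /=.
rewrite big1 => [|i _].
  rewrite mul1r [RHS]mpolyXE_id; apply: eq_bigr => i _.
  by rewrite rmorphXn /= rename_YX (unsplitK (inr i)) mnmE.
have := congr1 (fun u : 'X_{1..n} => u i) t0.
by rewrite !mnmE => ->; rewrite expr0 rmorph1.
Qed.

Lemma embed_YE f : embed_Y f = \sum_(u <- msupp f) f@_u *: 'X_[y_embed u].
Proof.
rewrite /embed_Y comp_mpolyEX; apply: eq_bigr => u _.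
by rewrite -/(embed_Y _) embed_Y_term.
Qed.

Lemma rename_YK g : only_Y g -> embed_Y (rename_Y g) = g.
Proof.
move=> /allP gY; apply: etrans (congr1 (embed_Y \o @rename_Y n R) (mpolyE g)) _.
rewrite [RHS](mpolyE g) /= (rmorph_sum (@rename_Y n R)) (rmorph_sum embed_Y).
rewrite big_seq [RHS]big_seq; apply: eq_bigr => t /gY /eqP t0 /=.
rewrite -!mul_mpolyC !rmorphM /= rename_YC embed_YC rename_Y_term //.
by rewrite embed_Y_term y_partK.
Qed.

Lemma mcoeff_embed_Y f u : (embed_Y f)@_(y_embed u) = f@_u.
Proof.
rewrite embed_YE [RHS](congr1 (mcoeff u) (mpolyE f)) !raddf_sum.
apply: eq_bigr => v _ /=.
by rewrite !mcoeffZ !mcoeffX (can_eq y_embedK).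
Qed.

Lemma only_Y_embed_Y f : only_Y (embed_Y f).
Proof.
apply/allP => t; rewrite embed_YE => /msupp_sum_le /flatten_mapP[u _].
by move=> /msuppZ_le; rewrite msuppX inE => /eqP ->; rewrite x_part_y_embed.
Qed.

Lemma msupp_embed_Y f t : t \in msupp (embed_Y f) ->
  exists2 u, u \in msupp f & t = y_embed u.
Proof.
move=> ft; have /allP /(_ t ft) /eqP t0 := only_Y_embed_Y f.
exists (y_part t); last by rewrite y_partK.
by rewrite mcoeff_msupp -mcoeff_embed_Y y_partK // -mcoeff_msupp.
Qed.

Variables (leX le : rel 'X_{1..n}).
Hypotheses (hleX : term_order leX) (hle : term_order le).
Let block := block_order leX le.

Lemma lpp_embed_Y f : f != 0 -> lpp block (embed_Y f) = y_embed (lpp le f).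
Proof.
move=> f0; apply: lpp_eq; first exact: block_order_term_order.
  by rewrite mcoeff_msupp mcoeff_embed_Y -mcoeff_msupp lpp_supp.
move=> _ /msupp_embed_Y[u fu ->].
by rewrite /block /block_order !x_part_y_embed eqxx !y_embedK lpp_max.
Qed.

Lemma lc_embed_Y f : f != 0 -> lc block (embed_Y f) = lc le f.
Proof. by move=> f0; rewrite /lc lpp_embed_Y // mcoeff_embed_Y. Qed.

(** The elimination property: the block order compares X-parts first and 0 is the least of them, so
    an X-free leading monomial bounds all others to be X-free. *)
Lemma only_Y_lpp g : x_part (lpp block g) = 0%MM -> only_Y g.
Proof.
have hb : term_order block by apply: block_order_term_order.
move=> g0; apply/allP => t /(lpp_max hb).
rewrite /block /block_order -/block g0; case: eqP => // neq0 t0.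
by case: neq0; apply: (to_anti hleX t0); apply: to_ge0.
Qed.

End Ring.
End YVariables.

Section GraphSubstitution.
Variables (K : finFieldType) (n : nat).

(** Restriction to the graph y = x^q. It kills the polynomials y_i - x_i^q and so carries the graph
    ideal back to the original one. *)
Definition graph_eval (g : {mpoly K[n + n]}) : {mpoly K[n]} :=
  g \mPo [tuple match split i with inl j => 'X_j | inr j => 'X_j ^+ #|K| end
         | i < n + n].

HB.instance Definition _ := GRing.RMorphism.copy graph_eval
  (comp_mpoly [tuple match split i with inl j => 'X_j | inr j => 'X_j ^+ #|K| end
              | i < n + n]).

Lemma graph_evalC c : graph_eval c%:MP = c%:MP.
Proof. exact: comp_mpolyC. Qed.

Lemma graph_eval_lshift i : graph_eval 'X_(lshift n i) = 'X_i.
Proof.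
by rewrite /graph_eval comp_mpolyXU -tnth_nth tnth_mktuple (unsplitK (inl i)). Qed.

Lemma graph_eval_rshift i : graph_eval 'X_(rshift n i) = 'X_i ^+ #|K|.
Proof.
by rewrite /graph_eval comp_mpolyXU -tnth_nth tnth_mktuple (unsplitK (inr i)). Qed.

Lemma graph_eval_embed_X (f : {mpoly K[n]}) : graph_eval (embed_X f) = f.
Proof.
apply: (mpoly_rmorph_eq (phi := (graph_eval \o @embed_X n K : {rmorphism _ -> _}))
  (psi := idfun)) => [c|i] /=.
  by rewrite embed_XC graph_evalC.
by rewrite embed_XX graph_eval_lshift.
Qed.

(** The two ring morphisms agree on constants because c^q = c in [K]. *)
Lemma graph_eval_embed_Y (f : {mpoly K[n]}) : graph_eval (embed_Y f) = f ^+ #|K|.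
Proof.
apply: (mpoly_rmorph_eq (phi := (graph_eval \o @embed_Y n K : {rmorphism _ -> _}))
  (psi := @frobenius K n)) => [c|i] /=.
  by rewrite embed_YC graph_evalC /frobenius -(rmorphXn (@mpolyC n K)) /= expf_card.
by rewrite embed_YX graph_eval_rshift.
Qed.

End GraphSubstitution.

Section SpecializeVariables.
Variables (K : finFieldType) (m n : nat) (a : point K m).

Lemma specializeC k (c : {mpoly K[m]}) :
  specialize a (c%:MP : {mpoly {mpoly K[m]}[k]}) = c.@[a]%:MP.
Proof. exact: map_mpolyC. Qed.

Lemma specialize_embed_X (f : {mpoly {mpoly K[m]}[n]}) :
  specialize a (embed_X f) = embed_X (specialize a f).
Proof.
apply: (mpoly_rmorph_eq
  (phi := (@specialize K m (n + n) a \o @embed_X n _ : {rmorphism _ -> _}))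
  (psi := (@embed_X n _ \o @specialize K m n a : {rmorphism _ -> _}))) => [c|i] /=.
  by rewrite embed_XC !specializeC embed_XC.
by rewrite embed_XX !specializeX embed_XX.
Qed.

Lemma specialize_embed_Y (f : {mpoly {mpoly K[m]}[n]}) :
  specialize a (embed_Y f) = embed_Y (specialize a f).
Proof.
apply: (mpoly_rmorph_eq
  (phi := (@specialize K m (n + n) a \o @embed_Y n _ : {rmorphism _ -> _}))
  (psi := (@embed_Y n _ \o @specialize K m n a : {rmorphism _ -> _}))) => [c|i] /=.
  by rewrite embed_YC !specializeC embed_YC.
by rewrite embed_YX !specializeX embed_YX.
Qed.

Variable F : {fset {mpoly {mpoly K[m]}[n]}}.

Lemma graph_ideal_eval g : special_ideal a (frobenius_graph F) g ->
  special_ideal a F (graph_eval g).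
Proof.
have idI := special_ideal_is_ideal a F.
apply: (special_ideal_least (ideal_preim (@graph_eval K n) idI)).
move=> h; rewrite inE => /orP[] /imfsetP[] /=.
  move=> f Ff ->; rewrite specialize_embed_X graph_eval_embed_X.
  exact: mem_special_ideal.
move=> i _ ->; rewrite rmorphB rmorphXn /= !specializeX rmorphB rmorphXn /=.
by rewrite graph_eval_lshift graph_eval_rshift subrr; apply: ideal0.
Qed.

Lemma graph_ideal_embed_X f :
  special_ideal a F f -> special_ideal a (frobenius_graph F) (embed_X f).
Proof.
have idB := special_ideal_is_ideal a (frobenius_graph F).
apply: (special_ideal_least (ideal_preim (@embed_X n K) idB)).
move=> g Fg; rewrite /= -specialize_embed_X; apply: mem_special_ideal.
by rewrite inE; apply/orP; left; apply: in_imfset.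
Qed.

(* Modulo y_i - x_i^q, the polynomial f(y) is f(x^q) = f(x)^q. *)
Lemma graph_ideal_embed_Y f : special_ideal a F (f ^+ #|K|) ->
  special_ideal a (frobenius_graph F) (embed_Y f).
Proof.
have idB := special_ideal_is_ideal a (frobenius_graph F).
move=> /graph_ideal_embed_X Bf; rewrite -[embed_Y f](subrK (embed_X (f ^+ #|K|))).
apply: idealD => //; apply: (mpoly_congr idB (phi := @embed_Y n K)
  (psi := (@embed_X n K \o @frobenius K n : {rmorphism _ -> _}))) => [c|i] /=.
  rewrite /frobenius -(rmorphXn (@mpolyC n K)) /= expf_card embed_YC embed_XC.
  by rewrite subrr; apply: ideal0.
rewrite /frobenius rmorphXn /= embed_YX embed_XX.
rewrite -!(specializeX a) -rmorphXn -rmorphB /=; apply: mem_special_ideal.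
by rewrite inE; apply/orP; right; apply: in_imfset.
Qed.

End SpecializeVariables.

(* The invariant of the segments met by the algorithm. *)
Definition basis_at (K : finFieldType) m n (le : rel 'X_{1..n})
    (a : point K m) (G : {fset {mpoly {mpoly K[m]}[n]}}) : Prop :=
  [/\ forall g, g \in G -> (lc le g).@[a] != 0,
      exists2 f, special_ideal a G f & f != 0
    & groebner_basis le (special_ideal a G) (specialize_set a G)].

(** A comprehensive Groebner system speaks of the ideal of its input, the invariant of the ideal of
    [G] itself; a Groebner basis generates, so the two coincide. *)
Lemma basis_atP (K : finFieldType) m n (le : rel 'X_{1..n}) (hle : term_order le)
    (a : point K m) (G : {fset {mpoly {mpoly K[m]}[n]}}) (I : {mpoly K[n]} -> Prop) :
  is_ideal I -> (forall g, g \in G -> (lc le g).@[a] != 0) ->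
  (exists2 f, I f & f != 0) -> groebner_basis le I (specialize_set a G) ->
  basis_at le a G /\ (forall f, special_ideal a G f <-> I f).
Proof.
move=> idI lcG [f If f0] gbG.
have eI h : special_ideal a G h <-> I h by apply: groebner_basisE gbG.
have [G0 GI Glpp] := gbG; split=> //; split=> //; first by exists f; rewrite ?eI.
by split=> // [g /GI /eI|h /eI]; last exact: Glpp.
Qed.

Section InverseFrobenius.
Variables (K : finFieldType) (m n : nat) (leX le : rel 'X_{1..n}).
Hypotheses (hleX : term_order leX) (hle : term_order le).
Variables (a : point K m) (F : {fset {mpoly {mpoly K[m]}[n]}}).
Hypothesis F_nz : exists2 f, special_ideal a F f & f != 0.
Let block := block_order leX le.

(** The elimination theorem at one point. For f^q in the ideal, f(y) lies in the graph ideal, and a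
    basis element whose leading monomial divides that of f(y) must be X-free. *)
Lemma inverse_frobenius_basis (G : {fset {mpoly {mpoly K[m]}[n + n]}}) :
  (forall g, g \in G -> (lc block g).@[a] != 0) ->
  groebner_basis block (special_ideal a (frobenius_graph F)) (specialize_set a G) ->
  let G' := [fset rename_Y g | g in G & only_Y g] in
  basis_at le a G' /\
  forall f, special_ideal a G' f <-> special_ideal a F (f ^+ #|K|).
Proof.
move=> lcG [G0 GB Glpp] G'.
have hb : term_order block by apply: block_order_term_order.
have idI := special_ideal_is_ideal a F.
have idI' : is_ideal (fun f => special_ideal a F (f ^+ #|K|)).
  exact: (ideal_preim (@frobenius K n)).
have rn0 g : g \in G -> only_Y g -> rename_Y g != 0.
  move=> Gg /rename_YK eg; apply: contraTneq (lcG g Gg) => g0.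
  by rewrite -eg g0 rmorph0 /lc mcoeff0 meval0 eqxx.
have lcg g : g \in G -> only_Y g -> (lc le (rename_Y g)).@[a] != 0.
  move=> Gg Yg; rewrite -(lc_embed_Y hleX hle) ?rn0 // rename_YK //.
  exact: lcG.
apply: (basis_atP hle idI').
- by move=> _ /imfsetP[g /= /andP[Gg Yg] ->]; apply: lcg.
- case: F_nz => f If f0; exists f => //.
  by rewrite -(prednK (card_field_gt0 K)) exprSr; apply: idealM.
split.
- move=> _ /imfsetP[_ /= /imfsetP[g /= /andP[Gg Yg] ->] ->].
  by apply: (@lc_neq0_inv _ le); rewrite lc_specialize // lcg.
- move=> _ /imfsetP[_ /= /imfsetP[g /= /andP[Gg Yg] ->] ->].
  rewrite -graph_eval_embed_Y -specialize_embed_Y rename_YK //.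
  by apply/graph_ideal_eval/GB/mem_specialize_set.
- move=> f /graph_ideal_embed_Y Bf f0.
  have Yf0 : embed_Y f != 0.
    apply: (@lc_neq0_inv _ block); rewrite (lc_embed_Y hleX hle) //.
    exact: lc_neq0.
  have [_ /imfsetP[g /= Gg ->]] := Glpp (embed_Y f) Bf Yf0.
  rewrite (lpp_specialize hb) ?lcG // (lpp_embed_Y hleX hle) // => gf.
  (* The selection of X-free elements is made before specialization; it is compatible because [g]
     keeps its leading monomial at [a]. *)
  have Yg : only_Y g by apply: (only_Y_lpp hleX hle); apply: x_part_eq0_lep gf.
  exists (specialize a (rename_Y g)).
    by apply: mem_specialize_set; apply: in_imfset; rewrite /= inE Gg.
  rewrite lpp_specialize ?lcg //; apply: y_embed_lep.
  by rewrite -(lpp_embed_Y hleX hle) ?rn0 // rename_YK.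
Qed.

End InverseFrobenius.

(** * Radicals in characteristic p *)

Section FrobeniusRadical.
Variables (K : finFieldType) (n : nat) (I : {mpoly K[n]} -> Prop).
Hypothesis idI : is_ideal I.
Local Notation q := #|K|.

Lemma ideal_expW (f : {mpoly K[n]}) k l : (k <= l)%N -> I (f ^+ k) -> I (f ^+ l).
Proof. by move=> kl; rewrite -(subnK kl) exprD => Ik; apply: idealM. Qed.

Lemma card_field_gt1 : (1 < q)%N.
Proof. exact: finNzRing_gt1. Qed.

Lemma frobenius_power_ideal N : is_ideal (fun f => I (f ^+ (q ^ N))).
Proof.
have idN : is_ideal (fun f => I (iter N (@frobenius K n) f)).
  elim: N => [|N IHN]; first exact: idI.
  have := ideal_preim (@frobenius K n) IHN.
  case=> i0 iD iM; split=> [|f g|c f]; rewrite !iterSr.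
  - exact: i0.
  - exact: iD.
  - exact: iM.
case: idN => i0 iD iM.
split=> [|f g|c f]; rewrite !frobenius_iter.
- exact: i0.
- exact: iD.
- exact: iM.
Qed.

(** Exponents may be restricted to powers of q since k < q^k. For these, taking powers is additive,
    which makes the radical an ideal without binomial expansions. *)
Lemma radicalP f : radical I f <-> exists N, I (f ^+ (q ^ N)).
Proof.
split=> [[k k0 Ik]|[N IN]]; last by exists (q ^ N)%N; rewrite // expn_gt0 card_field_gt0.
by exists k; apply: ideal_expW Ik; apply/ltnW/ltn_expl/card_field_gt1.
Qed.

Lemma frobenius_powerW f M N :
  (M <= N)%N -> I (f ^+ (q ^ M)) -> I (f ^+ (q ^ N)).
Proof. by move=> MN; apply: ideal_expW; rewrite leq_exp2l ?card_field_gt1. Qed.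

Lemma radical_is_ideal : is_ideal (radical I).
Proof.
split=> [|f g /radicalP[M fM] /radicalP[N gN]|c f /radicalP[N fN]]; apply/radicalP.
- by exists 0%N; rewrite expr1; apply: ideal0.
- exists (maxn M N); have [_ iD _] := frobenius_power_ideal (maxn M N).
  by apply: iD; [apply: frobenius_powerW fM; apply: leq_maxl
                |apply: frobenius_powerW gN; apply: leq_maxr].
- by exists N; have [_ _ iM] := frobenius_power_ideal N; apply: iM.
Qed.

(** A Groebner basis of the radical supplies finitely many generators. Their largest exponent serves
    all elements, as the f with f^(q^N) in [I] form an ideal. *)
Lemma radical_exponent (le : rel 'X_{1..n}) : term_order le ->
  exists N, forall f, radical I f -> I (f ^+ (q ^ N)).
Proof.
move=> hle; have [G [gbG _]] := minimal_groebner_basis_exists le (radical I).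
have [_ GI _] := gbG.
have [N NP] := finite_choice (D := fun g => g \in G) 0%N
  (fun g Gg => (radicalP g).1 (GI g Gg)).
exists (\max_(g <- G) N g)%N => f /(groebner_generates hle radical_is_ideal gbG).
apply: (ideal_gen_least (frobenius_power_ideal _)).
by move=> g Gg; apply: frobenius_powerW (NP g Gg); apply: leq_bigmax_seq.
Qed.

(** One q-th root is extracted from f^(q^N) at a time. *)
Lemma radical_of_root (f : {mpoly K[n]}) :
  (forall g, I (g ^+ q) -> I g) -> radical I f -> I f.
Proof.
move=> Iq /radicalP[N]; elim: N => [|N IHN]; first by rewrite expn0 expr1.
by rewrite expnSr exprM => /Iq.
Qed.

Lemma mem_radical f : I f -> radical I f.
Proof. by move=> If; exists 1%N. Qed.

Lemma radical_frobenius f : radical I (f ^+ q) -> radical I f.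
Proof.
by case=> k k0 Ik; exists (q * k)%N; rewrite ?muln_gt0 ?card_field_gt0 // exprM.
Qed.

End FrobeniusRadical.

Lemma radical_mono (R : comNzRingType) (I J : R -> Prop) f :
  (forall g, I g -> J g) -> radical I f -> radical J f.
Proof. by move=> IJ [k k0 /IJ Jk]; exists k. Qed.

(** * Partitions into segments *)

Section Partitions.
Variables (K : finFieldType) (m n : nat).
Implicit Types (s t u v : segment K m n) (a : point K m).

(** Phrased with a predicate because the outputs of the algorithm are specified by their membership
    conditions. *)
Definition segments_partition (S : {set point K m}) (P : segment K m n -> Prop) :=
  [/\ forall s, P s -> seg_locus s != finset.set0,
      forall s t, P s -> P t -> s != t -> [disjoint seg_locus s & seg_locus t]%bool
    & forall a, a \in S <-> exists2 s, P s & a \in seg_locus s].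

Lemma segments_partition_refine (S : {set point K m}) (C : {fset segment K m n})
    (P : segment K m n -> segment K m n -> Prop) :
  algebraic_partition S C ->
  (forall t, t \in C -> segments_partition (seg_locus t) (P t)) ->
  segments_partition S (fun u => exists2 t, t \in C & P t u).
Proof.
move=> partC partP; have [C0 Cd CS] := partC; split.
- by move=> u [t /partP[ne _ _] /ne].
- move=> u v [s Cs Psu] [t Ct Ptv] neuv.
  have [est|nest] := eqVneq s t.
    rewrite -est in Ptv; have [_ disj _] := partP s Cs.
    exact: disj neuv.
  apply/pred0P => a /=; apply/negP => /andP[ua va].
  have sa : a \in seg_locus s by have [_ _ cov] := partP s Cs; apply/cov; exists u.
  have ta : a \in seg_locus t by have [_ _ cov] := partP t Ct; apply/cov; exists v.
  by have /pred0P/(_ a) := Cd s t Cs Ct nest; rewrite /= sa ta.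
- move=> a; split=> [/CS[t Ct ta]|[u [t Ct Ptu] ua]].
    have [_ _ cov] := partP t Ct; have [u Pu ua] := (cov a).1 ta.
    by exists u => //; exists t.
  by apply/CS; exists t => //; have [_ _ cov] := partP t Ct; apply/cov; exists u.
Qed.

(** The hypothesis on [P] is conditional because recursion happens only when the second locus is
    nonempty. *)
Lemma segments_partition_split (e1 e2 : segment K m n) (L : {set point K m})
    (P : segment K m n -> Prop) :
  (forall a, a \in L <-> a \in seg_locus e1 \/ a \in seg_locus e2) ->
  (forall a, a \in seg_locus e1 -> a \in seg_locus e2 -> False) ->
  (seg_locus e2 != finset.set0 -> segments_partition (seg_locus e2) P) ->
  segments_partition L (fun u =>
    (seg_locus e1 != finset.set0 /\ u = e1) \/ (seg_locus e2 != finset.set0 /\ P u)).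
Proof.
move=> cov disj partP.
have disj1 u : seg_locus e2 != finset.set0 -> P u ->
    [disjoint seg_locus e1 & seg_locus u]%bool.
  move=> ne2 Pu; apply/pred0P => a /=; apply/negP => /andP[ea ua].
  apply: (disj a ea); have [_ _ covP] := partP ne2; apply/covP.
  by exists u.
split.
- by move=> u [[ne ->]|[/partP[ne _ _] /ne]].
- move=> u v [[ne1 ->]|[ne2 Pu]] [[ne1' ->]|[ne2' Pv]] neuv.
  + by rewrite eqxx in neuv.
  + exact: disj1.
  + by rewrite disjoint_sym; apply: disj1.
  + by have [_ disjP _] := partP ne2; apply: disjP.
- move=> a; rewrite cov; split=> [[e1a|e2a]|[u [[_ ->]|[ne2 Pu] ua]]].
  + by exists e1 => //; left; split=> //; apply/set0Pn; exists a.
  + have ne2 : seg_locus e2 != finset.set0 by apply/set0Pn; exists a.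
    have [_ _ covP] := partP ne2; have [u Pu ua] := (covP a).1 e2a.
    by exists u => //; right.
  + by left.
  + by right; have [_ _ covP] := partP ne2; apply/covP; exists u.
Qed.

Lemma segments_partition_fset S P (C : {fset segment K m n}) :
  (forall s, s \in C <-> P s) -> segments_partition S P -> algebraic_partition S C.
Proof.
move=> eCP [P0 Pd PS]; split.
- by move=> s /eCP /P0.
- by move=> s t /eCP Ps /eCP Pt; apply: Pd.
- move=> a; rewrite PS; split=> [] [s Ps sa]; exists s => //; exact/eCP.
Qed.

Lemma zerosU (E H : {fset {mpoly K[m]}}) a :
  (a \in zeros (E `|` H)) = (a \in zeros E) && (a \in zeros H).
Proof.
apply/zerosP/andP => [EH0|[/zerosP E0 /zerosP H0] g].
  by split; apply/zerosP => g gEH; apply: EH0; rewrite inE gEH ?orbT.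
by rewrite inE => /orP[/E0|/H0].
Qed.

(** Removing these zeros leaves the points of the old locus at which some element of [H] is nonzero:
    the complement of the first output segment. *)
Lemma zerosM (N H : {fset {mpoly K[m]}}) a :
  (a \in zeros [fset f * h | f in N, h in H]) = (a \in zeros N) || (a \in zeros H).
Proof.
apply/zerosP/orP => [NH0|NH0 _ /imfset2P[f /= Nf [h /= Hh ->]]]; last first.
  rewrite mevalM; case: NH0 => /zerosP Z.
    by rewrite (Z f Nf) mul0r.
  by rewrite (Z h Hh) mulr0.
have [|] := boolP (a \in zeros N); first by left.
rewrite inE => /allPn[f Nf fa]; right; apply/zerosP => h Hh; apply/eqP.
have /eqP : (f * h).@[a] = 0 by apply/NH0/imfset2P; exists f => //; exists h.
by rewrite mevalM mulf_eq0 (negPf fa).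
Qed.

End Partitions.

(** * The algorithm *)

Section Algorithm.
Variables (K : finFieldType) (m n : nat) (le : rel 'X_{1..n}).
Hypothesis hle : term_order le.
Local Notation seg := (segment K m n).
Local Notation I a s := (special_ideal a (seg_G s)).
Implicit Types (s t u : seg) (a : point K m).

Definition basis_on s : Prop := forall a, a \in seg_locus s -> basis_at le a (seg_G s).

Lemma inverse_frobenius_exists s : exists H, ParaInverseFrobeniusMap le s H.
Proof.
have hb : term_order (block_order le le) by apply: block_order_term_order.
have [C CGS] := CGS_exists hb (frobenius_graph (seg_G s)) (seg_locus s).
by exists [fset (seg_E t, seg_N t,
            [fset rename_Y g | g in seg_G t & only_Y g]) | t in C], le, C.
Qed.

Lemma inverse_frobenius_correct s H : basis_on s -> ParaInverseFrobeniusMap le s H ->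
  algebraic_partition (seg_locus s) H /\
  forall t, t \in H -> basis_on t /\
    forall a, a \in seg_locus t -> forall f, I a t f <-> I a s (f ^+ #|K|).
Proof.
move=> bs [leX [C [hleX [[C0 Cd CS] CB] ->]]]; split; first split.
- by move=> _ /imfsetP[t /= Ct ->]; apply: C0 Ct.
- move=> _ _ /imfsetP[t /= Ct ->] /imfsetP[u /= Cu ->] ne.
  by apply: Cd => //; apply: contra_neq ne => ->.
- move=> a; rewrite CS; split=> [[t Ct ta]|[_ /imfsetP[t /= Ct ->] ta]].
    exists (seg_E t, seg_N t, [fset rename_Y g | g in seg_G t & only_Y g]).
      exact: in_imfset.
    exact: ta.
  by exists t.
move=> _ /imfsetP[t /= Ct ->].
have key a : a \in seg_locus t ->
    let G' := [fset rename_Y g | g in seg_G t & only_Y g] in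
    basis_at le a G' /\ forall f, special_ideal a G' f <-> I a s (f ^+ #|K|).
  move=> ta; have sa : a \in seg_locus s by apply/CS; exists t.
  have [_ nz _] := bs a sa.
  have [/(_ a ta)[lct _ [gbt _]]|[_ /(_ a ta) B0]] := CB t Ct.
    exact: inverse_frobenius_basis gbt.
  (* The zero alternative cannot occur: a nonzero [f] of the old ideal embeds as a nonzero element
     of the graph ideal. *)
  case: nz => f /graph_ideal_embed_X /B0 f0 /eqP[].
  by rewrite -(graph_eval_embed_X f) f0 rmorph0.
by split=> a /key[].
Qed.

Lemma ideal_equality_exists s t : basis_on s ->
  exists out, ParaIdealEqualityLCS le s t out.
Proof.
move=> bs; have lcs a g : a \in seg_locus s -> g \in seg_G s -> (lc le g).@[a] != 0.
  by move=> /bs[lcs _ _]; apply: lcs.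
have [prem premP] := finite_choice (D := predT) 0 (fun f _ => prem_exists hle f lcs).
by eexists; exists prem; split=> [g _|]; [apply: premP | reflexivity].
Qed.

(** The set of coefficients vanishes at [a] exactly when every parametric remainder specializes to
    0, that is, when the generators of the second ideal lie in the first. *)
Lemma ideal_equality_correct s t out : basis_on s ->
  (forall a, a \in seg_locus t -> a \in seg_locus s) ->
  ParaIdealEqualityLCS le s t out ->
  [/\ seg_G out.1 = seg_G s, seg_G out.2 = seg_G t,
      forall a, a \in seg_locus out.1 <->
        a \in seg_locus t /\ forall f, I a t f -> I a s f
    & forall a, a \in seg_locus out.2 <->
        a \in seg_locus t /\ ~ forall f, I a t f -> I a s f].
Proof.
move=> bs sub_ts [prem [premP ->]] /=; set H := \bigcup_(g <- _) _.
have HP a : a \in seg_locus t ->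
    a \in zeros H <-> forall f, I a t f -> I a s f.
  move=> ta; have sa := sub_ts a ta; have [lcs _ gbs] := bs a sa.
  have premE g : g \in seg_G t ->
      specialize a (prem g) = 0 <-> I a s (specialize a g).
    by move=> Gg; apply: (prem_specialize hle) (premP g Gg).
  split=> [/zerosP H0 f|ts].
    apply: special_ideal_least; first exact: special_ideal_is_ideal.
    move=> g Gg; apply/premE => //; apply/mpolyP => x.
    rewrite mcoeff_specialize mcoeff0.
    have [hx|/memN_msupp_eq0 ->] := boolP (x \in msupp (prem g)); last exact: meval0.
    by apply/H0/bigfcupP; exists g; rewrite ?Gg //; apply/imfsetP; exists x.
  apply/zerosP => h /bigfcupP[g /andP[Gg _]] /imfsetP[x /= _ ->].
  have := (premE g Gg).2 (ts _ (mem_special_ideal a Gg)).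
  by rewrite -mcoeff_specialize => ->; rewrite mcoeff0.
split=> // a; rewrite !in_seg_locus /=.
  rewrite zerosU; split=> [/andP[/andP[Ea Ha] Na]|[/andP[Ea Na] ts]].
    have ta : a \in seg_locus t by rewrite in_seg_locus Ea Na.
    by rewrite Ea Na; split=> //; apply/HP.
  by rewrite Ea Na /= andbT; apply/HP; rewrite ?in_seg_locus ?Ea.
rewrite zerosM negb_or; split=> [/and3P[Ea Na Ha]|[/andP[Ea Na] nts]].
  have ta : a \in seg_locus t by rewrite in_seg_locus Ea Na.
  by rewrite Ea Na; split=> // /(HP a ta) Ha'; rewrite Ha' in Ha.
rewrite Ea Na /=; apply/negP => Ha; apply: nts; apply/HP => //.
by rewrite in_seg_locus Ea Na.
Qed.

(* Each recursive call replaces the ideal I_a by {f | f^q \in I_a}. *)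
Lemma main_terminates N s : basis_on s ->
  (forall a f, a \in seg_locus s -> radical (I a s) f -> I a s (f ^+ (#|K| ^ N))) ->
  ParaRadicalMain_terminates le s.
Proof.
elim: N s => [|N IHN] s bs radN; constructor; try exact: inverse_frobenius_exists;
  try by move=> H t _ _; apply: ideal_equality_exists.
all: move=> H t eqn invH Ht eqnP /nonempty_testP ne.
all: have [[_ _ covH] Hspec] := inverse_frobenius_correct bs invH.
all: have sub_ts a : a \in seg_locus t -> a \in seg_locus s
  by move=> ta; apply/covH; exists t.
all: have [bt eI] := Hspec t Ht.
all: have [_ G2 _ locus2] := ideal_equality_correct bs sub_ts eqnP.
  (* For N = 0 the ideals are already radical, so the inclusion holds everywhere and the second
     segment is empty. *)
  case/set0Pn: ne => a /locus2[ta []] f /(eI a ta) fq.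
  rewrite -[f]expr1; apply: radN; first exact: sub_ts.
  by exists #|K|; first exact: card_field_gt0.
apply: IHN => [a /locus2[ta _]|a f /locus2[ta _]]; rewrite G2; first exact: bt.
(* Membership of f^(q^N) in the new ideal is membership of f^(q^(N+1)) in the old one. *)
move=> radf; apply/(eI a ta); rewrite -exprM -expnSr.
apply: radN; first exact: sub_ts.
case: radf => k k0 /(eI a ta); rewrite -exprM => Ik.
by exists (k * #|K|)%N; rewrite ?muln_gt0 ?k0 ?card_field_gt0.
Qed.

Lemma basis_on_terminates s : basis_on s -> ParaRadicalMain_terminates le s.
Proof.
move=> bs; have idI a := special_ideal_is_ideal a (seg_G s).
have [N NP] := finite_choice (D := predT) 0%N
  (fun a _ => radical_exponent (idI a) hle).
apply: (main_terminates (N := \max_a N a)) => // a f _ /(NP a isT).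
by apply: frobenius_powerW => //; apply: leq_bigmax.
Qed.

(** The derivation of termination is a well-founded tree of calls; a run is assembled along it by
    choosing an outcome of each subroutine. *)
Lemma main_output_exists s :
  ParaRadicalMain_terminates le s -> exists out, ParaRadicalMain le s out.
Proof.
elim=> {}s [H invH] exeqn _ IH.
have [eqn eqnP] := finite_choice (D := fun t => t \in H) (s, s)
  (fun t Ht => exeqn H t invH Ht).
have [rec recP] := finite_choice
  (D := fun t => (t \in H) && (seg_locus (eqn t).2 != finset.set0)) fset0
  (P := fun t => ParaRadicalMain le (eqn t).2) (fun t Ht =>
    let: conj Ht1 Ht2 := andP Ht in
    IH H t (eqn t) invH Ht1 (eqnP t Ht1) ((nonempty_testP _).2 Ht2)).
pose out t := [fset u in [:: (eqn t).1] | seg_locus (eqn t).1 != finset.set0] `|`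
  [fset u in rec t | seg_locus (eqn t).2 != finset.set0].
exists (\bigcup_(t <- H) out t).
apply: (ParaRadicalMain_return (eqn := eqn) (rec := rec) invH eqnP).
  by move=> t Ht /nonempty_testP ne; apply: recP; rewrite Ht ne.
move=> u; split=> [/bigfcupP[t /andP[Ht _]]|[t Ht outu]].
  rewrite !inE /= => /orP[/andP[/eqP -> ne]|/andP[ut ne]]; exists t => //.
    by left; split=> //; apply/nonempty_testP.
  by right; split=> //; apply/nonempty_testP.
apply/bigfcupP; exists t; rewrite ?Ht // !inE /=.
by case: outu => -[/nonempty_testP -> ->]; rewrite ?eqxx ?orbT.
Qed.

Lemma main_correct s out : ParaRadicalMain le s out -> basis_on s ->
  algebraic_partition (seg_locus s) out /\
  forall u a, u \in out -> a \in seg_locus u ->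
    forall f, I a u f <-> radical (I a s) f.
Proof.
elim=> {}s H eqn rec {}out invH eqnP _ IH outP bs.
have [partH Hspec] := inverse_frobenius_correct bs invH.
have sub_ts t a : t \in H -> a \in seg_locus t -> a \in seg_locus s.
  by move=> Ht ta; have [_ _ cov] := partH; apply/cov; exists t.
have eqnS t (Ht : t \in H) :=
  ideal_equality_correct bs (fun a => sub_ts t a Ht) (eqnP t Ht).
have b2 t : t \in H -> basis_on (eqn t).2.
  move=> Ht a; have [_ -> _ l2] := eqnS t Ht; move=> /l2[ta _].
  by case: (Hspec t Ht) => bt _; apply: bt.
have rec_spec t : t \in H -> seg_locus (eqn t).2 != finset.set0 ->
    algebraic_partition (seg_locus (eqn t).2) (rec t) /\
    forall u a, u \in rec t -> a \in seg_locus u ->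
      forall f, I a u f <-> radical (I a (eqn t).2) f.
  by move=> Ht /nonempty_testP ne; apply: IH => //; apply: b2.
split.
  apply: (segments_partition_fset (P := fun u => exists2 t, t \in H &
     (seg_locus (eqn t).1 != finset.set0 /\ u = (eqn t).1) \/
     (seg_locus (eqn t).2 != finset.set0 /\ u \in rec t))).
    move=> u; rewrite outP; split=> -[t Ht Pu]; exists t => //.
      by case: Pu => -[/nonempty_testP ne Pu]; [left|right].
    by case: Pu => -[/nonempty_testP ne Pu]; [left|right].
  apply: segments_partition_refine => // t Ht.
  have [_ _ l1 l2] := eqnS t Ht.
  apply: segments_partition_split => [a|a|ne2].
  - rewrite l1 l2; split=> [ta|[[]|[]] //].
    by case: (classic (forall f, I a t f -> I a s f)) => H0; [left|right].
  - by move=> /l1[_ ts] /l2[_ []].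
  - by case: (rec_spec t Ht ne2).
move=> u a /outP[t Ht Pu] ua f; have idI := special_ideal_is_ideal a (seg_G s).
have [G1 G2 l1 l2] := eqnS t Ht; have [_ eI] := Hspec t Ht.
case: Pu => -[/nonempty_testP ne Pu].
  rewrite Pu in ua *; case/l1: ua => ta ts; rewrite G1.
  split=> [|radf]; first exact: mem_radical.
  by apply: radical_of_root radf => // g /(eI a ta) /ts.
have [[_ _ cov2] rad2] := rec_spec t Ht ne.
have /l2[ta _] : a \in seg_locus (eqn t).2 by apply/cov2; exists u.
(* It remains to compare the radicals of the old and the new ideal: a power in the new one has its
   q-th power in the old, and the old one is contained in the new. *)
rewrite (rad2 u a Pu ua) G2; split=> [[k k0 /(eI a ta) Ik]|].
  by apply: radical_frobenius; exists k; rewrite // -exprM mulnC exprM.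
apply: radical_mono => g Ig; apply/(eI a ta).
by rewrite -(prednK (card_field_gt0 K)) exprSr; apply: idealM.
Qed.

Lemma CGS_basis_on F S C s : is_CGS le F S C -> s \in C -> ~~ trivial_basis s ->
  basis_on s /\ forall a, a \in seg_locus s -> forall f, I a s f <-> special_ideal a F f.
Proof.
move=> [_ CB] Cs; rewrite negb_or => /andP[/eqP s0 _].
have [sB|[//]] := CB s Cs.
have key a : a \in seg_locus s ->
    basis_at le a (seg_G s) /\ forall f, I a s f <-> special_ideal a F f.
  move=> /sB[lcs nz [gbs _]]; apply: basis_atP => //.
  exact: special_ideal_is_ideal.
by split=> a /key[].
Qed.

(** Both trivial ideals are radical: the unit ideal obviously, the zero ideal because polynomials
    over a field have no nilpotents. *)
Lemma trivial_basis_radical F S C s a f : is_CGS le F S C -> s \in C ->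
  trivial_basis s -> a \in seg_locus s ->
  I a s f <-> radical (special_ideal a F) f.
Proof.
move=> [[C0 _ _] CB] Cs triv sa; have [sB|[Gs0 Fz]] := CB s Cs.
  (* A basis {0} contradicts nonvanishing leading coefficients, since [lc] of 0 is 0. *)
  case/orP: triv => /eqP Gs.
    have [/(_ 0) lc0 _ _] := sB a sa; move: lc0; rewrite Gs in_fset1 eqxx => /(_ isT).
    by rewrite /lc mcoeff0 meval0 eqxx.
  have [_ _ [[_ GI _] _]] := sB a sa.
  have one : specialize a 1 \in specialize_set a (seg_G s).
    by apply: mem_specialize_set; rewrite Gs in_fset1.
  have I1 h : special_ideal a F h.
    rewrite -[h]mulr1; apply: idealM; first exact: special_ideal_is_ideal.
    by rewrite -(rmorph1 (@specialize K m n a)); apply: GI.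
  have I1' h : I a s h.
    rewrite -[h]mulr1; apply: idealM; first exact: special_ideal_is_ideal.
    by rewrite -(rmorph1 (@specialize K m n a)); apply: mem_ideal_gen.
  by split=> // _; exists 1%N.
have id0 : is_ideal (fun g : {mpoly K[n]} => g = 0).
  by split=> // [g h -> ->|c g ->]; rewrite ?addr0 ?mulr0.
split=> [|[k _ /(Fz a sa) /eqP]]; last first.
  rewrite expf_eq0 => /andP[_ /eqP ->].
  by apply: ideal0; apply: special_ideal_is_ideal.
rewrite Gs0 => /(special_ideal_least id0) -> => [|g]; last first.
  by rewrite in_fset1 => /eqP ->; rewrite rmorph0.
by exists 1%N; rewrite // expr1; apply: ideal0; apply: special_ideal_is_ideal.
Qed.

End Algorithm.

Theorem proposition4p8 (K : finFieldType) (m n : nat) (le : rel 'X_{1..n})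
    (hle : term_order le) (F : {fset {mpoly {mpoly K[m]}[n]}}) :
  ParaRadical_terminates le F /\
  (exists R : {fset segment K m n}, ParaRadical le F R) /\
  (forall R : {fset segment K m n}, ParaRadical le F R ->
     parametric_radical_system F [set: point K m]%SET R).
Proof.
have [C CGS] := CGS_exists hle F finset.setT.
have term C' s : is_CGS le F finset.setT C' -> s \in C' -> ~~ trivial_basis s ->
    ParaRadicalMain_terminates le s.
  by move=> CGS' Cs /(CGS_basis_on hle CGS' Cs)[bs _]; apply: basis_on_terminates.
split; first by split; [exists C | exact: term].
split.
  have [main mainP] := finite_choice
    (D := fun s => (s \in C) && ~~ trivial_basis s) fset0
    (P := ParaRadicalMain le) (fun s Hs => let: conj Cs triv := andP Hs in
      main_output_exists (term C s CGS Cs triv)).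
  exists (\bigcup_(s <- C) if trivial_basis s then [fset s] else main s).
  exists C, main; split=> // [s Cs triv|u]; first by apply: mainP; rewrite Cs.
  split=> [/bigfcupP[s /andP[Cs _] us]|[s Cs us]].
    by exists s => //; case: ifP us; rewrite // inE => _ /eqP.
  by apply/bigfcupP; exists s; rewrite ?Cs //; case: ifP us => // _ ->; rewrite inE.
move=> R [C' [main [CGS' mainP RP]]]; have [partC _] := CGS'.
have spec s : s \in C' -> ~~ trivial_basis s ->
    algebraic_partition (seg_locus s) (main s) /\
    forall u a, u \in main s -> a \in seg_locus u ->
      forall f, special_ideal a (seg_G u) f <-> radical (special_ideal a F) f.
  move=> Cs triv; have [bs eI] := CGS_basis_on hle CGS' Cs triv.
  have [part rad] := main_correct hle (mainP s Cs triv) bs.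
  split=> // u a us ua f; rewrite (rad u a us ua).
  have sa : a \in seg_locus s by have [_ _ cov] := part; apply/cov; exists u.
  by split; apply: radical_mono => g /(eI a sa).
split.
  apply: segments_partition_fset RP _.
  apply: segments_partition_refine => // s Cs.
  (* A trivial segment is copied to the output and forms a partition of its own locus with one
     block. *)
  have [triv|triv] := boolP (trivial_basis s); last by case: (spec s Cs triv).
  have [/(_ s Cs) ne _ _] := partC.
  split=> [u ->|u v -> ->|a] //; first by rewrite eqxx.
  by split=> [sa|[u -> //]]; exists s.
move=> u a /RP[s Cs us] ua f.
have [triv|triv] := boolP (trivial_basis s); last first.
  by rewrite (negPf triv) in us; apply: (spec s Cs triv).2.
move: us ua; rewrite triv => -> ua.
exact: trivial_basis_radical CGS' Cs triv ua.
Qed.
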